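(* Let $K$ be a field, $n,m,r\in\mathbb{N}$, and $A$ a $G$-algebra over $K$ generated by two blocks of variables $x=\{x_1,\ldots,x_n\}$ and $y=\{y_1,\ldots,y_m\}$ such that $x$ generates a sub-$G$-algebra $B$ of $A$ contained in the center $Z(A)$ (so $B=K[x]$ is a commutative polynomial ring). Let $S:=B\setminus\{0\}$, let ${\leq}=(\leq_1,\leq_2)$ be an $(n,m)$-antiblock ordering satisfying the ordering condition for $G$-algebras on $A$, let $\preceq$ be the position-over-term ordering extending $\leq$ and $\preceq_2$ the position-over-term ordering extending $\leq_2$. Let $\varepsilon:A^r\to S^{-1}(A^r)$ be the localization map. Consider the following algorithm with input a left $A$-submodule $I$ of $A^r$: (1) compute a left Gröbner basis $H$ of $I$ with respect to $\preceq$; (2) let $h:=\sqrt{\prod_{g\in H}\mathrm{lc}_{\preceq_2}(\varepsilon(g))}\in K[x]\setminus\{0\}$; (3) compute $k:=\mathrm{Satindex}(I,h)$; (4) compute a left Gröbner basis $G$ of $I:h^k$ with respect to $\preceq$ and return $G$. This algorithm terminates and is correct, i.e. $G$ is a left Gröbner basis of the $S$-closure $I^S$ with respect to $\preceq$.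
   Context: Admissible orderings: a total ordering $\leq$ on $\mathbb{N}_0^N$ with least element $0$ such that $\alpha\leq\beta$ implies $\alpha+\gamma\leq\beta+\gamma$. $G$-algebra: a $K$-algebra $A=K\langle z_1,\ldots,z_N\mid z_jz_i=c_{ij}z_iz_j+d_{ij},\ 1\le i<j\le N\rangle$ with $c_{ij}\in K\setminus\{0\}$ and $d_{ij}$ a $K$-linear combination of standard monomials $z_1^{\alpha_1}\cdots z_N^{\alpha_N}$, such that the standard monomials form a $K$-basis of $A$ and there is an admissible ordering $\leq$ on $\mathbb{N}_0^N$ such that for all $i<j$ either $d_{ij}=0$ or the leading exponent of $d_{ij}$ is smaller than that of $z_iz_j$ (the ''ordering condition for $G$-algebras on $A$''). Leading exponents $\mathrm{le}$, leading monomials $\mathrm{lm}$ and leading coefficients $\mathrm{lc}$ are taken with respect to expansions in standard monomials. $G$-algebras are left and right Noetherian domains. Here the variables are ordered $x_1,\ldots,x_n,y_1,\ldots,y_m$. An $(n,m)$-antiblock ordering ${\leq}=(\leq_1,\leq_2)$ on $\mathbb{N}_0^{n+m}=\mathbb{N}_0^n\times\mathbb{N}_0^m$, for admissible orderings $\leq_1$ on $\mathbb{N}_0^n$ and $\leq_2$ on $\mathbb{N}_0^m$, is given by: $(\alpha_1,\alpha_2)\leq(\beta_1,\beta_2)$ iff $\alpha_2<_2\beta_2$, or $\alpha_2=\beta_2$ and $\alpha_1\leq_1\beta_1$. The position-over-term ordering on $\{1,\ldots,r\}\times\mathbb{N}_0^N$ extending an admissible ordering $\leq$: $(i,\alpha)$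 is less than or equal to $(j,\beta)$ iff $i<j$, or $i=j$ and $\alpha\leq\beta$. A pair $(i,\alpha)$ is the exponent of the monomial $z^\alpha e_i$, with $e_i$ the $i$-th standard basis vector; $z^\alpha e_i\mid z^\beta e_j$ means $i=j$ and $\alpha_k\le\beta_k$ for all $k$. A finite subset $G$ of a left submodule $I$ is a left Gröbner basis of $I$ if for all $f\in I\setminus\{0\}$ there is $g\in G$ with $\mathrm{lm}(g)\mid\mathrm{lm}(f)$; left Gröbner bases over $G$-algebras are computable. $S$ is a left Ore set of central elements of the domain $A$. $S^{-1}A$ is viewed as a $G$-algebra over the field $S^{-1}B=K(x)$ in the variables $y_1,\ldots,y_m$ with the relations inherited from $A$; monomials of $S^{-1}(A^r)\cong(S^{-1}A)^r$ are the $y^\alpha e_i$. The map $\varepsilon:A^r\to S^{-1}(A^r)$, $f\mapsto(1,f)$, is injective, and for $g\in A^r\setminus\{0\}$ the leading coefficient $\mathrm{lc}_{\preceq_2}(\varepsilon(g))$ lies in $K[x]\setminus\{0\}$. The $S$-closure of $I$ is $I^S:=\varepsilon^{-1}(S^{-1}I)$. For $f\in K[x]\setminus K$, the square-free part $\sqrt f$ is the product of the distinct (up to associates) irreducible factors of $f$; for $f\in K\setminus\{0\}$ put $\sqrt f:=1$. For $q\in Z(A)$: $I:q=\{f\in A^r\mid qf\in I\}$, $I:q^\infty=\bigcup_{i\ge0}(I:q^i)$, and $\mathrm{Satindex}(I,q)=\min(\{j\in\mathbb{N}_0\mid (I:q^\infty)=(I:q^j)\}\cup\{\infty\})$. Central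 quotients by given elements and the (finite) saturation index are computable. *)

(* Defs.v *)
From HB Require Import structures.
From mathcomp Require Export all_boot all_order all_algebra.
From mathcomp Require Export finmap mpoly.

Set Implicit Arguments.
Unset Strict Implicit.
Unset Printing Implicit Defensive.

Import GRing.Theory.
Local Open Scope ring_scope.

(* N_0^N is the type 'X_{1..N}; a non-strict ordering on it is a [rel]. *)
Definition admissible (N : nat) (le : rel 'X_{1..N}) : Prop :=
  [/\ antisymmetric le, transitive le, total le,
      forall a, le 0%MM a
    & forall a b c, le a b -> le (a + c)%MM (b + c)%MM].

Section Antiblock.
Variables n m : nat.

Definition xpart (a : 'X_{1..n + m}) : 'X_{1..n} :=
  [multinom a (lshift m i) | i < n].
Definition ypart (a : 'X_{1..n + m}) : 'X_{1..m} :=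
  [multinom a (rshift n j) | j < m].

Definition antiblock (le1 : rel 'X_{1..n}) (le2 : rel 'X_{1..m}) :
    rel 'X_{1..n + m} :=
  fun a b => (ypart a != ypart b) && le2 (ypart a) (ypart b)
          || (ypart a == ypart b) && le1 (xpart a) (xpart b).

End Antiblock.

Definition greatest (T : Type) (le : rel T) (P : T -> Prop) (a : T) : Prop :=
  P a /\ forall b, P b -> le b a.

Section Exponents.
Variables r N : nat.

Definition pot (le : rel 'X_{1..N}) : rel ('I_r * 'X_{1..N}) :=
  fun e e' => (e.1 < e'.1)%N || (e.1 == e'.1) && le e.2 e'.2.

Definition mon_dvd (e e' : 'I_r * 'X_{1..N}) : Prop :=
  e.1 = e'.1 /\ forall k, (e.2 k <= e'.2 k)%N.

End Exponents.

(* The factors of the product are taken in increasing order of the index. *)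
Definition stdmon (C : pzRingType) (N : nat) (z : 'I_N -> C) (a : 'X_{1..N}) : C :=
  \prod_(i < N) z i ^+ a i.

(* An element p of {mpoly R[N]} serves here only as a finitely supported
   family of coefficients (p@_a) indexed by N_0^N. *)
Definition lincomb (R : nzRingType) (V : lmodType R) (N : nat)
    (mon : 'X_{1..N} -> V) (p : {mpoly R[N]}) : V :=
  \sum_(a <- msupp p) p@_a *: mon a.

Section GAlgebra.
Variables (K : fieldType) (N : nat).
Variables (c : 'I_N -> 'I_N -> K) (d : 'I_N -> 'I_N -> {mpoly K[N]}).

(* Only the values of c and d at i < j are relevant; d i j lists the
   coefficients of d_ij in the standard monomials. *)
Definition galg_relations (C : algType K) (z : 'I_N -> C) : Prop :=
  forall i j : 'I_N, (i < j)%N ->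
    z j * z i = c i j *: (z i * z j) + lincomb (stdmon z) (d i j).

Definition ordering_condition (le : rel 'X_{1..N}) : Prop :=
  forall i j : 'I_N, (i < j)%N ->
    d i j = 0 \/
    exists a, [/\ greatest le (fun b => b \in msupp (d i j)) a,
                  le a (U_(i) + U_(j))%MM & a != (U_(i) + U_(j))%MM].

(* [galg_pres] : A, with z, is the algebra presented by the relations, in the
   form of the universal property of the presentation. *)
Record galgebra (A : algType K) (z : 'I_N -> A) : Prop := {
  galg_rel : galg_relations z;
  galg_pres : forall (C : algType K) (w : 'I_N -> C), galg_relations w ->
    exists f : {lrmorphism A -> C}, (forall i, f (z i) = w i) /\
      forall g : {lrmorphism A -> C}, (forall i, g (z i) = w i) -> g =1 f;
  galg_coef : forall i j : 'I_N, (i < j)%N -> c i j != 0;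
  galg_basis : forall a : A, exists! p, lincomb (stdmon z) p = a;
  galg_order : exists le, admissible le /\ ordering_condition le }.

End GAlgebra.

Section Blocks.
Variables (K : fieldType) (n m : nat) (A : algType K) (z : 'I_(n + m) -> A).

Definition xvar (i : 'I_n) : A := z (lshift m i).
Definition yvar (j : 'I_m) : A := z (rshift n j).

(* The canonical map K[x] -> A. *)
Definition xpoly (p : {mpoly K[n]}) : A := lincomb (stdmon xvar) p.

Definition inB (b : A) : Prop := exists p, b = xpoly p.
Definition inS (s : A) : Prop := inB s /\ s <> 0.

(* The relations between the x_i involve x only, so that their standard
   monomials span a subalgebra, which is [inB]. *)
Definition x_sub_galgebra (d : 'I_(n + m) -> 'I_(n + m) -> {mpoly K[n + m]}) :
    Prop :=
  forall i j : 'I_n, (i < j)%N ->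
    forall a, a \in msupp (d (lshift m i) (lshift m j)) -> ypart a = 0%MM.

Definition B_central : Prop := forall b, inB b -> forall a, b * a = a * b.

End Blocks.

(* Q, with phi, is the left localization S^-1 A: phi a is the fraction (1, a),
   and phi s * q = phi a says that q is the fraction (s, a). *)
Record is_localization (A Q : pzRingType) (S : A -> Prop)
    (phi : {rmorphism A -> Q}) : Prop := {
  loc_unit : forall s, S s -> exists q, q * phi s = 1 /\ phi s * q = 1;
  loc_frac : forall q, exists s a, S s /\ phi s * q = phi a;
  loc_ker : forall a, phi a = 0 <-> exists s, S s /\ s * a = 0 }.

(* R is the ring of coefficients and mon enumerates a basis of V over R, so
   that the elements of V^r expand uniquely in the monomials [mon a] e_i. *)
Section Leading.
Variables (R : nzRingType) (V : lmodType R) (N r : nat).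
Variables (mon : 'X_{1..N} -> V) (le : rel 'X_{1..N}).

Definition leading (f : 'rV[V]_r) (e : 'I_r * 'X_{1..N}) (lc : R) : Prop :=
  exists u : 'I_r -> {mpoly R[N]},
    [/\ forall i, f 0 i = lincomb mon (u i),
        greatest (pot le) (fun e' => e'.2 \in msupp (u e'.1)) e
      & lc = (u e.1)@_e.2].

Definition lexp (f : 'rV[V]_r) (e : 'I_r * 'X_{1..N}) : Prop :=
  exists lc, leading f e lc.

End Leading.

Section Submodules.
Variables (K : fieldType) (N r : nat) (A : algType K).
Implicit Types (I : 'rV[A]_r -> Prop) (q : A).

Record left_submodule I : Prop := {
  lsub0 : I 0;
  lsubD : forall f g, I f -> I g -> I (f + g);
  lsubZ : forall a f, I f -> I (a *: f) }.

Definition groebner (z : 'I_N -> A) (le : rel 'X_{1..N}) I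
    (G : {fset 'rV[A]_r}) : Prop :=
  (forall g, g \in G -> I g) /\
  forall f, I f -> f <> 0 ->
    exists g e e', [/\ g \in G, lexp (stdmon z) le g e,
                       lexp (stdmon z) le f e' & mon_dvd e e'].

Definition colon I q : 'rV[A]_r -> Prop := fun f => I (q *: f).
Definition colon_inf I q : 'rV[A]_r -> Prop :=
  fun f => exists i, colon I (q ^+ i) f.

Definition saturated_at I q (j : nat) : Prop :=
  forall f, colon_inf I q f <-> colon I (q ^+ j) f.

(* [None] stands for the index infinity. *)
Definition is_satindex I q (k : option nat) : Prop :=
  match k with
  | Some j => saturated_at I q j /\ forall i, saturated_at I q i -> (j <= i)%N
  | None => forall j, ~ saturated_at I q j
  end.

Variables (Q : pzRingType) (phi : {rmorphism A -> Q}) (S : A -> Prop).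

(* The localization map A^r -> S^-1 (A^r) = (S^-1 A)^r. *)
Definition eps (f : 'rV[A]_r) : 'rV[Q]_r := map_mx phi f.

Definition loc_submodule I : 'rV[Q]_r -> Prop :=
  fun v => exists s g, [/\ S s, I g & phi s *: v = eps g].

Definition S_closure I : 'rV[A]_r -> Prop := fun f => loc_submodule I (eps f).

End Submodules.

Section SquareFreePart.
Variable R : idomainType.
Implicit Types p q : R.

Definition divides p q : Prop := exists t, q = t * p.
Definition associates p q : Prop := exists2 u, u \is a GRing.unit & q = u * p.
Definition irreducible p : Prop :=
  [/\ p != 0, p \isn't a GRing.unit
    & forall q1 q2, p = q1 * q2 ->
        q1 \is a GRing.unit \/ q2 \is a GRing.unit].

(* Determined up to a unit. When f is a unit, l is empty and s = 1. *)
Definition is_sqfree_part (f s : R) : Prop :=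
  exists l : seq R,
    [/\ forall p, p \in l -> irreducible p /\ divides p f,
        forall p, irreducible p -> divides p f ->
          exists2 p', p' \in l & associates p' p,
        uniq l /\ (forall p p', p \in l -> p' \in l -> associates p p' -> p = p')
      & s = \prod_(p <- l) p].

End SquareFreePart.

Section Algorithm.
Variables (K : fieldType) (n m r : nat) (A : algType K).
Variables (z : 'I_(n + m) -> A).
Variables (le1 : rel 'X_{1..n}) (le2 : rel 'X_{1..m}).
Variables (Q : algType {fraction {mpoly K[n]}}) (phi : {rmorphism A -> Q}).
Variable I : 'rV[A]_r -> Prop.

Let le := antiblock le1 le2.

(* lc(eps g) in K(x), with respect to the monomials y^a e_i of S^-1 (A^r). *)
Definition lc_eps (g : 'rV[A]_r) (c : {fraction {mpoly K[n]}}) : Prop :=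
  exists e, leading (stdmon (fun j => phi (yvar z j))) le2 (eps phi g) e c.

(* The zero vector, which a Groebner basis may contain, has no leading
   coefficient and is skipped. *)
Definition is_h (H : {fset 'rV[A]_r}) (h : {mpoly K[n]}) : Prop :=
  exists c : 'rV[A]_r -> {mpoly K[n]},
    (forall g, g \in H -> g != 0 -> lc_eps g (tofrac (c g))) /\
    is_sqfree_part (\prod_(g <- H | g != 0) c g) h.

Inductive state : Type :=
| Start
| HaveH of {fset 'rV[A]_r}
| Haveh of {mpoly K[n]}
| Havek of {mpoly K[n]} & option nat
| Return of {fset 'rV[A]_r}.

(* A subroutine may return any value that meets its specification. The last
   step requires a finite k: the algorithm is stuck in [Havek h None]. *)
Inductive step : state -> state -> Prop :=
| Step1 H : groebner z le I H -> step Start (HaveH H)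
| Step2 H h : is_h H h -> step (HaveH H) (Haveh h)
| Step3 h k : is_satindex I (xpoly z h) k -> step (Haveh h) (Havek h k)
| Step4 h k G : groebner z le (colon I (xpoly z h ^+ k)) G ->
    step (Havek h (Some k)) (Return G).

(* Total correctness: every run from s is finite, is never stuck before
   [Return], and returns a value satisfying post. *)
Inductive terminates_with (post : {fset 'rV[A]_r} -> Prop) : state -> Prop :=
| TW_return G : post G -> terminates_with post (Return G)
| TW_step s : (exists s', step s s') ->
    (forall s', step s s' -> terminates_with post s') ->
    terminates_with post s.

End Algorithm.

Arguments Start {K n r A}.

(* Main.v *)
From HB Require Import structures.
From Stdlib Require Import Classical_Prop ClassicalEpsilon.
From mathcomp Require Import zify.
Require Import Defs.
Set Implicit Arguments.
Unset Strict Implicit.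
Unset Printing Implicit Defensive.
Import GRing.Theory.
Local Open Scope ring_scope.

(** The polynomial ring P = K[x] is central in A, and an antiblock ordering
    compares the exponents of y first. Hence A is free over P on the standard
    monomials y^b, and y^a y^b equals k y^(a+b) plus P-multiples of monomials
    that are smaller for the second ordering, with k a nonzero constant
    ([y_mon_mul]). Forgetting the x-part turns leading exponents over K into
    leading exponents over P ([lead_ypart]), and these are the leading exponents
    over K(x) in the localization ([lead_eps]).

    If f lies in the S-closure of I, then q f lies in I for some nonzero q in P,
    and some g in H has a leading exponent dividing that of q f. Since q only
    affects the x-part, the leading y-exponent of g divides that of f. Multiplying
    f by the leading coefficient of g (up to a constant) and subtracting a
    multiple of g yields an element of the S-closure with a smaller leading
    y-exponent. The ordering is well founded, so a product of constants and of
    leading coefficients of elements of H sends f into I ([pseudo_reduction]).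
    Such a product divides a power of h, because every irreducible factor of a
    leading coefficient is associated to a factor of h ([sqfree_part_power]).
    This gives one inclusion of I^S = (I : h^infinity) ([S_closure_colon]); the
    other holds because powers of h lie in S.

    The saturation index is finite by the same reduction, carried out over K
    ([saturates]): a Groebner basis of (I : h^infinity) is a finite set, thus
    contained in some (I : h^k), and reducing by it shows that the two submodules
    coincide. Groebner bases exist by Dickson's lemma.

    Two ingredients stand behind these steps. A product of standard monomials
    has the expected leading exponent ([mon_mul_nz]), by well-founded induction
    on the sum of the exponents, using the quasi-commutation relations. Square-free
    parts exist because a nonzero polynomial has finitely many divisors up to
    associates ([mpoly_finite_divisors]): the Kronecker substitution of
    sufficiently sparse powers of one variable for the x_i is injective on these
    divisors and reduces the question to one variable. *)

(** * Dickson's lemma and admissible orderings *)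

Lemma fun_choice (T U : Type) (P : T -> U -> Prop) :
  (forall x, exists y, P x y) -> exists f, forall x, P x (f x).
Proof.
move=> exP; pose w x := constructive_indefinite_description _ (exP x).
by exists (fun x => proj1_sig (w x)) => x; apply: proj2_sig (w x).
Qed.

Definition strict (T : eqType) (le : rel T) : rel T :=
  fun a b => (a != b) && le a b.

Lemma seq_greatest (T : eqType) (le : rel T) (s : seq T) :
  total le -> transitive le -> s != [::] ->
  exists2 a, a \in s & forall b, b \in s -> le b a.
Proof.
move=> tot tr; have refl x : le x x by have := tot x x; rewrite orbb.
elim: s => // x [|y s] IH _.
  by exists x; rewrite ?mem_head // => b; rewrite inE => /eqP ->.
have [a sa maxa] := IH isT; case/orP: (tot x a) => [xa|ax].
  by exists a => [|b]; rewrite in_cons ?sa ?orbT // => /predU1P[-> //|/maxa].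
exists x => [|b]; first exact: mem_head.
by rewrite in_cons => /predU1P[-> //|/maxa ba]; apply: tr ba ax.
Qed.

(** Dickson's lemma restricted to the first k coordinates, which makes induction
    on k possible without changing the type of exponents. If M bounds the k-th
    coordinate on a basis for the first k coordinates, that basis still works
    for elements whose k-th coordinate is at least M; the remaining elements lie
    in finitely many slices on which the k-th coordinate is constant. *)
Lemma dickson_coord (N k : nat) (P : 'X_{1..N} -> Prop) :
  exists l : seq 'X_{1..N}, (forall a, a \in l -> P a) /\
    forall b, P b -> exists2 a, a \in l &
      forall i, (i < k)%N -> (nth 0%N a i <= nth 0%N b i)%N.
Proof.
elim: k P => [|k IH] P.
  have [[a Pa]|noP] := classic (exists a, P a); last first.
    by exists [::]; split=> // b Pb; case: noP; exists b.
  exists [:: a]; split=> [b|b Pb]; first by rewrite inE => /eqP ->.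
  by exists a; rewrite ?mem_head.
have [l0 [l0P l0dvd]] := IH P.
have slices M : exists l : seq 'X_{1..N}, (forall a, a \in l -> P a) /\
    forall b, P b -> (nth 0%N b k < M)%N -> exists2 a, a \in l &
      forall i, (i < k.+1)%N -> (nth 0%N a i <= nth 0%N b i)%N.
  elim: M => [|M [l [lP ldvd]]]; first by exists [::].
  have [l' [l'P l'dvd]] := IH (fun a => P a /\ nth 0%N a k = M).
  exists (l ++ l'); split=> [a|b Pb].
    by rewrite mem_cat => /orP[/lP|/l'P[]].
  rewrite ltnS leq_eqVlt => /predU1P[bM|bM].
    have [a l'a ab] := l'dvd b (conj Pb bM).
    exists a; first by rewrite mem_cat l'a orbT.
    move=> i; rewrite ltnS leq_eqVlt => /predU1P[->|/ab //].
    by rewrite bM (l'P _ l'a).2.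
  by have [a la ab] := ldvd b Pb bM; exists a => //; rewrite mem_cat la.
pose M := \max_(a <- l0) nth 0%N a k.
have [l [lP ldvd]] := slices M.
exists (l0 ++ l); split=> [a|b Pb]; first by rewrite mem_cat => /orP[/l0P|/lP].
have [bM|Mb] := ltnP (nth 0%N b k) M.
  by have [a la ab] := ldvd b Pb bM; exists a => //; rewrite mem_cat la orbT.
have [a l0a ab] := l0dvd b Pb; exists a; first by rewrite mem_cat l0a.
move=> i; rewrite ltnS leq_eqVlt => /predU1P[->|/ab //].
by apply: leq_trans Mb; rewrite /M (big_rem a) //= leq_maxl.
Qed.

Lemma dickson (N : nat) (P : 'X_{1..N} -> Prop) :
  exists l : seq 'X_{1..N}, (forall a, a \in l -> P a) /\
    forall b, P b -> exists2 a, a \in l & (a <= b)%MM.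
Proof.
have [l [lP ldvd]] := dickson_coord N P; exists l; split=> // b Pb.
have [a la ab] := ldvd b Pb; exists a => //.
by apply/mnm_lepP => i; rewrite !(mnm_nth 0%N) ab.
Qed.

Lemma dickson_pos (r N : nat) (P : 'I_r * 'X_{1..N} -> Prop) :
  exists l : seq ('I_r * 'X_{1..N}), (forall e, e \in l -> P e) /\
    forall e, P e -> exists2 e', e' \in l & mon_dvd e' e.
Proof.
have first_pos k : exists l : seq ('I_r * 'X_{1..N}),
    (forall e, e \in l -> P e) /\
    forall e, P e -> (e.1 < k)%N -> exists2 e', e' \in l & mon_dvd e' e.
  elim: k => [|k [l [lP ldvd]]]; first by exists [::].
  have [kr|rk] := ltnP k r; last first.
    by exists l; split=> // e Pe _; apply: ldvd => //; apply: leq_trans rk.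
  pose i := Ordinal kr.
  have [l' [l'P l'dvd]] := dickson (fun a => P (i, a)).
  exists (l ++ [seq (i, a) | a <- l']); split=> [e|e Pe].
    by rewrite mem_cat => /orP[/lP //|/mapP[a /l'P Pa ->]].
  rewrite ltnS leq_eqVlt => /predU1P[ek|ek].
    have ei : e.1 = i by apply: val_inj.
    have [|a l'a ab] := l'dvd e.2; first by rewrite -ei -surjective_pairing.
    exists (i, a); first by rewrite mem_cat map_f ?orbT.
    by split=> //= j; apply: (mnm_lepP ab).
  by have [a la ab] := ldvd e Pe ek; exists a => //; rewrite mem_cat la.
have [l [lP ldvd]] := first_pos r; exists l; split=> // e Pe.
exact: ldvd (ltn_ord _).
Qed.

Section Admissible.
Variables (N : nat) (le : rel 'X_{1..N}).
Hypothesis adm : admissible le.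

Lemma adm_refl a : le a a.
Proof. by have [_ _ tot _ _] := adm; have := tot a a; rewrite orbb. Qed.

Lemma adm_dvd a b : (a <= b)%MM -> le a b.
Proof.
move=> ab; have [_ _ _ le0 leD] := adm.
by rewrite -(submK ab) -{1}[a]add0m leD.
Qed.

Lemma strict_add2r c a b : strict le a b -> strict le (a + c)%MM (b + c)%MM.
Proof.
have [_ _ _ _ leD] := adm.
by case/andP=> ab lab; rewrite /strict eqm_add2r ab leD.
Qed.

Lemma strict_le_trans b a c : strict le a b -> le b c -> strict le a c.
Proof.
have [as_ tr _ _ _] := adm; case/andP=> ab lab lbc.
rewrite /strict (tr _ _ _ lab lbc) andbT.
by apply: contraNneq ab => ac; apply/eqP/as_; rewrite lab ac lbc.
Qed.

Lemma strict_add a c : c != 0%MM -> strict le a (c + a)%MM.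
Proof.
move=> c0; rewrite /strict adm_dvd ?lem_addl // andbT.
by apply: contra c0; rewrite -{1}[a]add0m eqm_add2r eq_sym.
Qed.

(** A nonempty set of exponents has a least element: the least one in a finite
    Dickson basis, since an admissible ordering refines divisibility. *)
Lemma adm_wf : well_founded (strict le).
Proof.
move=> a; apply: NNPP => nAa.
have [as_ tr tot _ _] := adm.
have [l [lP ldvd]] := dickson (fun a => ~ Acc (strict le) a).
have [|||c lc minc] := @seq_greatest _ (fun a b => le b a) l.
- by move=> x y; apply: tot.
- by move=> y x z xy yz; apply: tr yz xy.
- by have [b lb _] := ldvd a nAa; apply: contraTneq lb => ->.
apply: (lP c lc); constructor=> b /andP[bc lebc]; apply: NNPP => nAb.
have [d ld db] := ldvd b nAb; case/eqP: bc; apply: as_; rewrite lebc.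
exact: tr (minc d ld) (adm_dvd db).
Qed.

Section Pot.
Variable r : nat.

Lemma pot_total : total (@pot r N le).
Proof.
have [_ _ tot _ _] := adm => e f; rewrite /pot -!val_eqE /=.
by have := tot e.2 f.2; case: ltngtP => //= _; rewrite ?orbT.
Qed.

Lemma pot_trans : transitive (@pot r N le).
Proof.
have [_ tr _ _ _] := adm => f e g; rewrite /pot -!val_eqE /=.
case/orP=> [ef|/andP[/eqP -> ef]] /orP[fg|/andP[/eqP <- fg]].
- by rewrite (ltn_trans ef fg).
- by rewrite ef.
- by rewrite fg.
- by rewrite ltnn eqxx (tr _ _ _ ef fg).
Qed.

Lemma pot_antisym : antisymmetric (@pot r N le).
Proof.
have [as_ _ _ _ _] := adm => -[i a] [j b]; rewrite /pot -!val_eqE /=.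
have [//|//|/val_inj ->/= ab] := ltngtP i j.
by rewrite (as_ _ _ ab).
Qed.

Lemma strict_potE i a j b :
  strict (@pot r N le) (i, a) (j, b) = (i < j)%N || (i == j) && strict le a b.
Proof.
rewrite /strict /pot /= xpair_eqE -!val_eqE /=.
by case: ltngtP => //= ij; rewrite ?andbF ?andbT // orbF.
Qed.

Lemma pot_wf : well_founded (strict (@pot r N le)).
Proof.
case=> i a; move: {2}(i : nat) (erefl (i : nat)) => k.
elim/ltn_ind: k i a => k IHk i a ik.
elim/(well_founded_ind adm_wf): a => a IHa.
constructor=> -[j b]; rewrite strict_potE => /orP[ji|/andP[/eqP -> ba]].
  by apply: (IHk j) => //; rewrite -ik.
exact: IHa.
Qed.

End Pot.
End Admissible.

(** * Products of standard monomials *)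

(** The variables do not commute, so the factor z_i can be pulled out in front
    only when no variable precedes it in the monomial. *)
Lemma mon_cons (A : nzRingType) (N : nat) (z : 'I_N -> A) (i : 'I_N) (b : 'X_{1..N}) :
  (forall l : 'I_N, (l < i)%N -> b l = 0%N) ->
  mmap1 z (U_(i) + b)%MM = z i * mmap1 z b.
Proof.
move=> b0; pose ord j := insubd i j.
have to_nat m : mmap1 z m = \prod_(0 <= j < N) z (ord j) ^+ m (ord j).
  by rewrite big_mkord; apply: eq_bigr => j _; rewrite /ord valKd.
have ordE j : (j < N)%N -> val (ord j) = j by move=> jN; rewrite val_insubd jN.
have split_i (m : 'X_{1..N}) : (forall l : 'I_N, (l < i)%N -> m l = 0%N) ->
    mmap1 z m = z i ^+ m i * \prod_(i.+1 <= j < N) z (ord j) ^+ m (ord j).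
  move=> m0; rewrite to_nat (big_cat_nat (n := i)) //=; last exact: ltnW.
  rewrite big_nat_cond big1 ?mul1r => [|j /andP[/andP[_ ji] _]]; last first.
    by rewrite m0 ?expr0 // ordE // (ltn_trans ji).
  by rewrite big_ltn // /ord valKd.
rewrite (split_i b) // split_i => [|l li]; last first.
  by rewrite mnmDE mnm1E b0 // -val_eqE /= gtn_eqF.
rewrite mnmDE mnm1E eqxx exprS -!mulrA; congr (_ * (_ * _)).
apply: eq_big_nat => j /andP[ij jN].
by rewrite mnmDE mnm1E -val_eqE /= ordE // ltn_eqF.
Qed.

(** The coefficients enter A through a central ring morphism iota rather than
    through a module structure, so that the same lemmas apply to A over K, to A
    over K[x] and to the localization over K(x). The map [mmap iota z] evaluates
    a family of coefficients on the standard monomials. *)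
Section Expansion.
Variables (R : idomainType) (A : nzRingType) (iota : {rmorphism R -> A}).
Variables (N : nat) (z : 'I_N -> A) (le : rel 'X_{1..N}).
Hypothesis iotaC : forall p a, iota p * a = a * iota p.
Hypothesis adm : admissible le.

Local Notation expand := (mmap iota z).
Local Notation mon := (mmap1 z).

Definition low (s : 'X_{1..N}) (a : A) : Prop :=
  exists p, a = expand p /\ forall d, d \in msupp p -> strict le d s.

Lemma low0 s : low s 0.
Proof. by exists 0; rewrite mmap0 msupp0. Qed.

Lemma lowD s a b : low s a -> low s b -> low s (a + b).
Proof.
move=> [p [-> lp]] [q [-> lq]]; exists (p + q); rewrite mmapD; split=> // d.
by move/msuppD_le; rewrite mem_cat => /orP[/lp|/lq].
Qed.

Lemma lowZ s c a : low s a -> low s (iota c * a).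
Proof.
by move=> [p [-> lp]]; exists (c *: p); rewrite mmapZ; split=> // d /msuppZ_le/lp.
Qed.

Lemma lowN s a : low s a -> low s (- a).
Proof. by rewrite -mulN1r -(rmorphN1 iota); apply: lowZ. Qed.

Lemma low_mon s d : strict le d s -> low s (mon d).
Proof.
by move=> ds; exists 'X_[d]; rewrite mmapX; split=> // d'; rewrite msuppX inE => /eqP->.
Qed.

Lemma low_le s t a : le s t -> low s a -> low t a.
Proof.
by move=> st [p [-> lp]]; exists p; split=> // d /lp ds; apply: strict_le_trans st.
Qed.

(** Stated for additive and homogeneous F so as to cover left and right
    multiplications at once. *)
Lemma low_big s t a (F : A -> A) : {morph F : x y / x + y} -> F 0 = 0 ->
  (forall c x, F (iota c * x) = iota c * F x) -> low s a ->
  (forall d, strict le d s -> low t (F (mon d))) -> low t (F a).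
Proof.
move=> FD F0 FZ [p [-> lp]] lowF; rewrite /mmap.
elim: (msupp p) lp => [|d ds IH] lp; first by rewrite big_nil F0; apply: low0.
rewrite big_cons FD FZ; apply: lowD; first by apply/lowZ/lowF/lp/mem_head.
by apply: IH => d' ds'; apply: lp; rewrite inE ds' orbT.
Qed.

Lemma low_mull s t a b : low s a ->
  (forall d, strict le d s -> low t (b * mon d)) -> low t (b * a).
Proof.
apply: (low_big (F := fun x => b * x)); first exact: mulrDr.
  exact: mulr0.
by move=> c x; rewrite mulrA -iotaC mulrA.
Qed.

Lemma low_mulr s t a b : low s a ->
  (forall d, strict le d s -> low t (mon d * b)) -> low t (a * b).
Proof.
apply: (low_big (F := fun x => x * b)).
- by move=> x y; apply: mulrDl.
- exact: mul0r.
- by move=> c x; rewrite mulrA.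
Qed.

(** The set T is a parameter because pseudo-reduction must keep track of the
    leading constants of the products that it uses. *)
Definition mon_mul (T : R -> Prop) a b : Prop :=
  exists c v, [/\ T c, low (a + b)%MM v & mon a * mon b = iota c * mon (a + b)%MM + v].

Lemma mon_mul_low T a b s :
  mon_mul T a b -> strict le (a + b)%MM s -> low s (mon a * mon b).
Proof.
move=> [c [v [_ lv ->]]] abs; apply: lowD; first exact/lowZ/low_mon.
by apply: low_le lv; case/andP: abs.
Qed.

Section Quasicommutation.
Variables (c : 'I_N -> 'I_N -> R) (d : 'I_N -> 'I_N -> {mpoly R[N]}).
Hypothesis rel_z : forall i j : 'I_N, (i < j)%N ->
  z j * z i = iota (c i j) * (z i * z j) + expand (d i j).
Hypothesis cN0 : forall i j : 'I_N, (i < j)%N -> c i j != 0.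
Hypothesis d_low : forall i j : 'I_N, (i < j)%N -> forall a, a \in msupp (d i j) ->
  strict le a (U_(i) + U_(j))%MM.

Let nz (x : R) := x != 0.

Lemma first_var (b : 'X_{1..N}) : b != 0%MM ->
  exists k b', b = (U_(k) + b')%MM /\ forall l : 'I_N, (l < k)%N -> b l = 0%N.
Proof.
move=> b0; have [l0 bl0] : exists l, b l != 0%N.
  apply/existsP; apply: contraR b0 => /existsPn bz.
  by apply/eqP/mnmP => l; rewrite mnm0E; apply/eqP/negPn/bz.
case: (@arg_minnP _ l0 (fun l => b l != 0%N) val) => // k bk mink.
exists k, (b - U_(k))%MM; rewrite addmC submK ?lep1mP //; split=> // l lk.
by apply/eqP; apply: contraTT lk => /mink; rewrite -leqNgt.
Qed.

(** Well-founded induction on a + b. The essential case is z_i z^b where b starts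
    with a variable z_k, k < i: the relation exchanges z_i and z_k at the cost of
    d_ki, and all resulting products of monomials, except the leading one, have a
    smaller sum of exponents. The leading one becomes standard because z_k comes
    before every variable that remains. *)
Lemma mon_mul_nz a b : mon_mul nz a b.
Proof.
move s_def: (a + b)%MM => s; elim/(well_founded_ind (adm_wf adm)): s a b s_def.
move=> s IH0; have {IH0}IH a b : strict le (a + b)%MM s -> mon_mul nz a b.
  by move=> abs; apply: IH0 abs _ _ erefl.
have U0 (i : 'I_N) : U_(i)%MM != 0%MM by rewrite mnm1_eq0.
have var_mul i b : (U_(i) + b)%MM = s -> mon_mul nz U_(i)%MM b.
  move=> s_def; have [|] := boolP [exists l : 'I_N, (l < i)%N && (b l != 0%N)];
    last first.
    move/existsPn=> b0; exists 1, 0; split; [exact: oner_neq0|exact: low0|].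
    rewrite addr0 rmorph1 mul1r mmap1U mon_cons // => l li.
    by have := b0 l; rewrite li negbK => /eqP.
  case/existsP=> l /andP[li bl].
  have [|k [b' [b_def bk]]] := first_var (b := b).
    by apply: contraNneq bl => ->; rewrite mnm0E.
  have ki : (k < i)%N.
    by apply: leq_ltn_trans li; rewrite leqNgt; apply: contra bl => /bk ->.
  have b'0 (m : 'I_N) : (m < k)%N -> b' m = 0%N.
    by move=> /bk /eqP; rewrite b_def mnmDE addn_eq0 => /andP[_ /eqP].
  have s_k : s = (U_(k) + (U_(i) + b'))%MM by rewrite -s_def b_def !addmA [(U_(i) + _)%MM]addmC.
  have [|c' [v [c'0 lv Uib']]] := IH U_(i)%MM b'.
    by rewrite s_k; apply: strict_add.
  exists (c k i * c'), (iota (c k i) * (z k * v) + expand (d k i) * mon b').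
  rewrite s_def; split; first by rewrite /nz mulf_neq0 ?cN0.
    apply: lowD.
      apply: lowZ; apply: low_mull lv _ => e eU; rewrite -mmap1U.
      apply: (@mon_mul_low nz); first apply: IH.
        by rewrite s_k ![(U_(k) + _)%MM]addmC; apply: strict_add2r.
      by rewrite s_k ![(U_(k) + _)%MM]addmC; apply: strict_add2r.
    apply: (@low_mulr (U_(k) + U_(i))%MM); first by exists (d k i); split=> // e; apply: d_low.
    move=> e ed; have es : strict le (e + b')%MM s.
      by rewrite s_k addmA; apply: strict_add2r.
    by apply: (@mon_mul_low nz) => //; apply: IH.
  rewrite mmap1U b_def mon_cons // mulrA rel_z // mulrDl addrA; congr (_ + _).
  rewrite -mulrA -mulrA -{1}(mmap1U z i) Uib' mulrDr mulrDr; congr (_ + _).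
  rewrite [z k * _]mulrA -[z k * iota _]iotaC -!mulrA -mon_cons -?s_k ?rmorphM -?mulrA //.
  by move=> m mk; rewrite mnmDE mnm1E b'0 // -val_eqE /= gtn_eqF // (ltn_trans mk).
move=> a b s_def; have [->|a0] := eqVneq a 0%MM.
  exists 1, 0; split; [exact: oner_neq0|exact: low0|].
  by rewrite add0m mmap11 rmorph1 addr0.
have [i [a' [a_def ai]]] := first_var a0.
have a'0 (m : 'I_N) : (m < i)%N -> a' m = 0%N.
  by move=> /ai /eqP; rewrite a_def mnmDE addn_eq0 => /andP[_ /eqP].
have s_i : s = (U_(i) + (a' + b))%MM by rewrite -s_def a_def addmA.
have [|c1 [v1 [c10 lv1 a'b]]] := IH a' b; first by rewrite s_i; apply: strict_add.
have [c2 [v2 [c20 lv2 Uia'b]]] := var_mul i (a' + b)%MM (esym s_i).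
exists (c2 * c1), (iota c1 * v2 + z i * v1); rewrite s_def; split.
- by rewrite /nz mulf_neq0.
- apply: lowD; first by apply: lowZ; rewrite s_i.
  apply: low_mull lv1 _ => e ea; rewrite -mmap1U; apply: (@mon_mul_low nz); first apply: IH.
    by rewrite s_i ![(U_(i) + _)%MM]addmC; apply: strict_add2r.
  by rewrite s_i ![(U_(i) + _)%MM]addmC; apply: strict_add2r.
rewrite a_def mon_cons // -mulrA a'b mulrDr mulrA -iotaC -mulrA -(mmap1U z i) Uia'b.
by rewrite mulrDr mulrA -rmorphM [c1 * _]mulrC -s_i addrA.
Qed.

End Quasicommutation.
End Expansion.

(** * Leading exponents and pseudo-reduction *)

Section Leads.
Variables (R : idomainType) (A : nzRingType) (iota : {rmorphism R -> A}).
Variables (N r : nat) (z : 'I_N -> A) (le : rel 'X_{1..N}).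
Hypothesis adm : admissible le.

Local Notation expand := (mmap iota z).
Local Notation mon := (mmap1 z).

(** The analogue of [leading] for coefficients acting through iota. *)
Definition lead (f : 'rV[A]_r) (e : 'I_r * 'X_{1..N}) (p : R) : Prop :=
  exists u : 'I_r -> {mpoly R[N]},
    [/\ forall i, f 0 i = expand (u i),
        greatest (pot le) (fun e' => e'.2 \in msupp (u e'.1)) e
      & p = (u e.1)@_e.2].

(** Components of f at positions below that of e are unconstrained, as positions
    are compared first. *)
Definition vlow (e : 'I_r * 'X_{1..N}) (f : 'rV[A]_r) : Prop :=
  forall i, exists p, f 0 i = expand p /\
    forall a, a \in msupp p -> strict (pot le) (i, a) e.

Lemma lead_expand (f : 'rV[A]_r) (u : 'I_r -> {mpoly R[N]}) :
  (forall i, f 0 i = expand (u i)) -> f != 0 ->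
  exists e, e.2 \in msupp (u e.1) /\ lead f e (u e.1)@_e.2.
Proof.
move=> fu f0.
pose s := [seq (i, a) | i <- enum 'I_r, a <- msupp (u i)].
have sE e : (e \in s) = (e.2 \in msupp (u e.1)).
  apply/allpairsPdep/idP => [[i [a [_ ua ->]]] //|ue].
  by exists e.1, e.2; rewrite mem_enum -surjective_pairing.
have [|e se maxe] := seq_greatest (pot_total adm (r:=r)) (pot_trans adm (r:=r)) (s := s).
  apply: contra f0 => /eqP s0; apply/eqP/rowP => i; rewrite mxE fu.
  rewrite /mmap big_seq big1 // => a ua.
  by have := sE (i, a); rewrite ua s0.
exists e; rewrite -sE; split=> //; exists u; split=> //; split; first by rewrite -sE.
by move=> e' ue'; apply: maxe; rewrite sE.
Qed.

Lemma vlow_lead e f : vlow e f -> f != 0 ->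
  exists e' p, strict (pot le) e' e /\ lead f e' p.
Proof.
move=> /fun_choice[u fu] f0.
have [e' [ue' lead_f]] := lead_expand (fun i => (fu i).1) f0.
exists e', (u e'.1)@_e'.2; split=> //.
by rewrite [e']surjective_pairing; apply: (fu _).2.
Qed.

Lemma lead_neq0 f e p : lead f e p -> p != 0.
Proof. by move=> [u [_ [ue _] ->]]; rewrite -mcoeff_msupp. Qed.

Lemma lead_top f e p : lead f e p ->
  exists2 v, low iota z le e.2 v & f 0 e.1 = iota p * mon e.2 + v.
Proof.
move=> [u [fu [ue maxe] ->]].
exists (expand (u e.1 - (u e.1)@_e.2 *: 'X_[e.2])); last first.
  by rewrite mmapB mmapZ mmapX addrC subrK.
exists (u e.1 - (u e.1)@_e.2 *: 'X_[e.2]); split=> // a.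
rewrite mcoeff_msupp mcoeffB mcoeffZ mcoeffX.
have [<-|ae] := eqVneq e.2 a; first by rewrite mulr1 subrr eqxx.
rewrite mulr0 subr0 -mcoeff_msupp => ua.
have := maxe (e.1, a) ua; rewrite /pot ltnn eqxx /= => lea.
by rewrite /strict lea eq_sym ae.
Qed.

Lemma lead_above f e p (i : 'I_r) : lead f e p -> (e.1 < i)%N -> f 0 i = 0.
Proof.
move=> [u [-> [_ maxe] _]] ei; suff -> : u i = 0 by rewrite mmap0.
have maxi a : a \in msupp (u i) -> pot le (i, a) e := maxe (i, a).
apply/eqP; rewrite -msupp_eq0; case: (msupp (u i)) maxi => // a s /(_ a (mem_head _ _)).
rewrite /pot /=.
by rewrite ltnNge ltnW //= -val_eqE /= gtn_eqF.
Qed.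

Hypothesis free : forall p : {mpoly R[N]}, expand p = 0 -> p = 0.

Lemma lead_vec_neq0 f e p : lead f e p -> f != 0.
Proof.
move=> [u [fu [ue _] _]]; apply: contraTneq ue => f0.
by rewrite (free (p := u e.1)) ?msupp0 // -fu f0 mxE.
Qed.

Lemma lead_unique f e p e' p' :
  lead f e p -> lead f e' p' -> e = e' /\ p = p'.
Proof.
move=> [u [fu [ue maxe] ->]] [u' [fu' [ue' maxe'] ->]].
have uu' i : u i = u' i.
  by apply/subr0_eq/free; rewrite mmapB -fu -fu' subrr.
suff -> : e = e' by rewrite uu'.
by apply: (pot_antisym adm); rewrite maxe ?maxe' // ?uu' // -uu'.
Qed.

Lemma low_vlow (e : 'I_r * 'X_{1..N}) (f : 'rV[A]_r) :
  (forall i : 'I_r, (e.1 < i)%N -> f 0 i = 0) -> low iota z le e.2 (f 0 e.1) ->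
  (forall a, exists p, a = expand p) -> vlow e f.
Proof.
case: e => j b /= f0 [p [fp lp]] span i; case: (ltngtP i j) => ij.
- have [q fq] := span (f 0 i); exists q; split=> // a _.
  by rewrite strict_potE ij.
- by exists 0; rewrite f0 // mmap0 msupp0.
- move/val_inj: ij => ->; exists p; split=> // a /lp lab.
  by rewrite strict_potE eqxx lab orbT.
Qed.

End Leads.

Section PseudoReduction.
Variables (F : fieldType) (R : idomainType) (A : algType F).
Variables (iota : {rmorphism R -> A}) (N r : nat) (z : 'I_N -> A).
Variable le : rel 'X_{1..N}.
Hypothesis adm : admissible le.
Hypothesis iotaC : forall p a, iota p * a = a * iota p.
Hypothesis span : forall a, exists p, a = mmap iota z p.

Variable T : R -> Prop.
Hypothesis T1 : T 1.
Hypothesis TM : forall s t, T s -> T t -> T (s * t).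
Hypothesis mulT : forall a b, mon_mul iota z le T a b.

Variables I J : 'rV[A]_r -> Prop.
Hypotheses (subI : left_submodule I) (subJ : left_submodule J).
Hypothesis IJ : forall f, I f -> J f.
Hypothesis lead_dvd : forall f e a, J f -> lead iota z le f e a ->
  exists g e' p, [/\ I g, lead iota z le g e' p, T p & mon_dvd e' e].

(** Well-founded induction on the leading exponent of f. The multiplicative set T
    collects the leading coefficients of the reducers and the constants of
    [mon_mul], which need not be invertible in R. For R = K and T the nonzero
    scalars this is ordinary reduction by a Groebner basis. *)
Theorem pseudo_reduction f : J f -> exists2 t, T t & I (iota t *: f).
Proof.
move=> Jf; have [->|f0] := eqVneq f 0.
  by exists 1; rewrite // scaler0; apply: lsub0.
have [u fu] := fun_choice (fun i => span (f 0 i)).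
have [e [_]] := lead_expand adm fu f0; move: (_@__) => a {u fu f0}.
elim/(well_founded_ind (pot_wf adm (r := r))): e f a Jf => e IH f a Jf lead_f.
have [g [e' [p [Ig lead_g Tp [pos_eq dvd]]]]] := lead_dvd Jf lead_f.
  have {}dvd : (e'.2 <= e.2)%MM by apply/mnm_lepP.
pose b := (e.2 - e'.2)%MM; have bE : (b + e'.2)%MM = e.2 by apply: submK.
have [c [v [Tc low_v mul_b]]] := mulT b e'.2.
pose q := iota a * mmap1 z b.
have Jf1 : J (iota (c * p) *: f - q *: g).
  by apply: lsubD; rewrite -?scaleNr //; apply: lsubZ => //; apply: IJ.
have low_f1 : vlow iota z le e (iota (c * p) *: f - q *: g).
  apply: low_vlow => // [i ei|].
    rewrite !mxE (lead_above lead_f) // (lead_above lead_g) ?pos_eq //.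
    by rewrite !mulr0 subrr.
  rewrite !mxE; have [w low_w ->] := lead_top lead_f.
  have [w' low_w' g_top] := lead_top lead_g; rewrite -pos_eq g_top.
  (* The leading terms of (c p) f and of (a z^b) g are both c p a z^e. *)
  have -> : iota (c * p) * (iota a * mmap1 z e.2 + w) -
      q * (iota p * mmap1 z e'.2 + w') =
      iota (c * p) * w - iota a * (iota p * v + mmap1 z b * w').
    rewrite /q !mulrDr !mulrA -[iota a * mmap1 z b * iota p]mulrA -[_ * iota p]iotaC.
    rewrite mulrA -[_ * mmap1 z b * mmap1 z e'.2]mulrA mul_b bE mulrDr !mulrA.
    rewrite -!rmorphM [a * p * c]mulrC [a * p]mulrC mulrA.
    by rewrite !opprD !addrA; congr (_ - _ - _); rewrite addrAC subrr add0r.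
  apply: lowD; first exact: lowZ.
  apply/lowN/lowZ/lowD; first by apply: lowZ; rewrite -bE.
  apply: (low_mull iotaC low_w') => d de; apply: mon_mul_low (mulT b d) _ => //.
  by rewrite -bE ![(b + _)%MM]addmC; apply: strict_add2r.
have [t Tt It] : exists2 t, T t & I (iota t *: (iota (c * p) *: f - q *: g)).
  have [->|f10] := eqVneq (iota (c * p) *: f - q *: g) 0.
    by exists 1; rewrite // scaler0; apply: lsub0.
  have [e1 [a1 [e1e lead_f1]]] := vlow_lead adm low_f1 f10.
  exact: IH e1e _ _ Jf1 lead_f1.
exists (t * (c * p)); first by do !apply: TM.
rewrite rmorphM -scalerA.
have -> : iota t *: (iota (c * p) *: f) =
    iota t *: (iota (c * p) *: f - q *: g) + (iota t * q) *: g.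
  by rewrite -scalerA -scalerDr subrK.
by apply: lsubD => //; apply: lsubZ.
Qed.

End PseudoReduction.

(** * Square-free parts of multivariate polynomials *)

Section FiniteDivisors.
Variable R : idomainType.
Implicit Types f p : R.

Lemma associates_refl p : associates p p.
Proof. by exists 1; rewrite ?unitr1 ?mul1r. Qed.

Lemma associates_sym p q : associates p q -> associates q p.
Proof. by move=> [u Uu ->]; exists u^-1; rewrite ?unitrV // mulKr. Qed.

Lemma associates_trans q p s : associates p q -> associates q s -> associates p s.
Proof. by move=> [u Uu ->] [v Uv ->]; exists (v * u); rewrite ?unitrM ?Uu ?Uv ?mulrA. Qed.

(** A finite list meeting all classes of divisors is thinned out to one irreducible
    divisor of f per class that contains one. *)
Lemma sqfree_part_exists f :
  (exists s : seq R, forall p, divides p f -> exists2 q, q \in s & associates q p) ->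
  exists h, is_sqfree_part f h.
Proof.
move=> [s s_div].
suff [l [l_irr l_div l_assoc]] : exists l : seq R,
    [/\ forall p, p \in l -> irreducible p /\ divides p f,
        forall p, irreducible p -> divides p f ->
          (exists2 q, q \in s & associates q p) -> exists2 q, q \in l & associates q p
      & uniq l /\ forall p q, p \in l -> q \in l -> associates p q -> p = q].
  by exists (\prod_(p <- l) p), l; split=> // p ip pf; apply: l_div => //; apply: s_div.
elim: s {s_div} => [|q s [l [l_irr l_div [l_uniq l_assoc]]]].
  by exists [::]; split=> // p _ _ [].
have [[p0 [[ip0 p0f] qp0 newp0]]|noq] := classic (exists p,
    [/\ irreducible p /\ divides p f, associates q p
      & forall p', p' \in l -> ~ associates p' p]).
  exists (p0 :: l); split.
  - by move=> p; rewrite inE => /predU1P[-> //|/l_irr].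
  - move=> p ip pf [q']; rewrite inE => /predU1P[->|sq'] q'p.
      by exists p0; [exact: mem_head|apply: associates_trans q'p; apply: associates_sym].
    have [|p1 lp1 p1p] := l_div p ip pf; first by exists q'.
    by exists p1; rewrite // inE lp1 orbT.
  - split=> [|p p']; first by rewrite /= l_uniq andbT; apply/negP=> /newp0[]; apply: associates_refl.
    rewrite !inE => /predU1P[->|lp] /predU1P[-> //|lp'] pp'; last exact: l_assoc.
      by case: (newp0 _ lp'); apply: associates_sym.
    by case: (newp0 _ lp).
exists l; split=> // p ip pf [q']; rewrite inE => /predU1P[->|sq'] q'p; last first.
  by apply: l_div => //; exists q'.
apply: NNPP => no_l; case: noq; exists p; split=> // p' lp' p'p.
by case: no_l; exists p'.
Qed.

End FiniteDivisors.

(** Transports finiteness along a relation to a finite list: one preimage is picked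
    for each element of s that has one. *)
Lemma finite_section (T U : eqType) (P : T -> Prop) (rel : T -> U -> Prop) (s : seq U) :
  exists l : seq T, forall x u, P x -> u \in s -> rel x u ->
    exists2 y, y \in l & P y /\ rel y u.
Proof.
elim: s => [|v s [l lP]]; first by exists [::].
have [[x0 Px0]|nox] := classic (exists x, P x /\ rel x v).
  exists (x0 :: l) => x u Px; rewrite inE => /predU1P[->|su] xu.
    by exists x0; rewrite ?mem_head.
  by have [y ly Py] := lP x u Px su xu; exists y; rewrite // inE ly orbT.
exists l => x u Px; rewrite inE => /predU1P[->|su] xu; last exact: lP su xu.
by case: nox; exists x.
Qed.

Section Kronecker.
Variable K : fieldType.

Lemma irreducible_divisor (p : {poly K}) : (1 < size p)%N ->
  exists2 q, irreducible_poly q & q %| p.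
Proof.
move: {2}(size p) (leqnn (size p)) => k; elim: k p => [|k IH] p sk s1.
  by rewrite leqn0 in sk; rewrite (eqP sk) in s1.
have [ip|/not_and_or[//|nip]] := classic (irreducible_poly p); first by exists p.
have [q [sq qp nqp]] : exists q : {poly K}, [/\ size q != 1%N, q %| p & ~ q %= p].
  by apply: NNPP => noq; apply: nip => q sq qp; apply: NNPP => nqp; apply: noq; exists q.
have p0 : p != 0 by rewrite -size_poly_gt0 ltnW.
have [||d id dq] := IH q.
- rewrite -ltnS; apply: leq_trans sk; rewrite ltn_neqAle dvdp_leq // andbT.
  by apply/negP; rewrite dvdp_size_eqp.
- by rewrite ltn_neqAle eq_sym sq size_poly_gt0; apply: contraTneq qp => ->; rewrite dvd0p.
by exists d => //; apply: dvdp_trans qp.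
Qed.

(** Split off an irreducible factor q, p = p' q. A divisor of p is either coprime to
    q, and then divides p', or a multiple of q, and then its quotient by q does. *)
Lemma poly_finite_divisors (p : {poly K}) : p != 0 ->
  exists l : seq {poly K}, forall d, d %| p -> exists2 d', d' \in l & d %= d'.
Proof.
move: {2}(size p) (leqnn (size p)) => k; elim: k p => [|k IH] p sk p0.
  by move: p0; rewrite -size_poly_gt0 ltnNge sk.
have [s1|s1] := leqP (size p) 1.
  exists [:: 1] => d dp; exists 1; rewrite ?mem_head // -size_poly_eq1.
  have d0 : d != 0 by apply: contraTneq dp => ->; rewrite dvd0p.
  by rewrite eqn_leq size_poly_gt0 d0 (leq_trans (dvdp_leq p0 dp)).
have [q iq /dvdpP[p' p_def]] := irreducible_divisor s1.
have [q0 p'0] : q != 0 /\ p' != 0.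
  by move: p0; rewrite p_def mulf_eq0 negb_or => /andP[].
have [|//|l lP] := IH p'.
  move: sk; rewrite p_def size_mul //; have [q1 _] := iq; case: (size q) q1 => [|[|b]] // _.
  by rewrite !addnS /= ltnS => /(leq_trans (leq_addr _ _)).
exists (l ++ [seq d * q | d <- l]) => d dp.
have [qd|nqd] := boolP (q %| d).
  have /dvdpP[d' d_def] := qd; have [|e le d'e] := lP d'.
    by rewrite -(dvdp_mul2r _ _ q0) -d_def -p_def.
  exists (e * q); first by rewrite mem_cat (map_f (fun d => d * q)) ?orbT.
  by rewrite d_def eqp_mulr.
have [|e le de] := lP d; last by exists e; rewrite // mem_cat le.
rewrite -(@Gauss_dvdpl _ p' q d) -?p_def //.
by rewrite coprimep_sym irreducible_poly_coprime.
Qed.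

Lemma digits_inj (n D : nat) (f g : nat -> nat) :
  (forall i, (i < n)%N -> (f i < D)%N && (g i < D)%N) ->
  (\sum_(i < n) f i * D ^ i = \sum_(i < n) g i * D ^ i)%N ->
  forall i, (i < n)%N -> f i = g i.
Proof.
elim: n f g => // n IH f g fgD; rewrite !big_ord_recl !expn0 !muln1.
have shift (u : nat -> nat) : (\sum_(i < n) u (lift ord0 i) * D ^ (lift ord0 i) =
    (\sum_(i < n) u i.+1 * D ^ i) * D)%N.
  by rewrite big_distrl; apply: eq_bigr => i _; rewrite /= /bump add1n expnSr mulnA.
rewrite !shift => eq_sum; have /andP[f0 g0] := fgD 0%N isT.
have fg0 : f 0%N = g 0%N.
  by have := congr1 (modn^~ D) eq_sum; rewrite /= ![(_ + _ * D)%N]addnC !modnMDl !modn_small.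
have D0 : (0 < D)%N by apply: leq_ltn_trans f0.
case=> [_ //|i]; rewrite ltnS.
apply: (IH (fun i => f i.+1) (fun i => g i.+1)) => [j jn|]; first exact: fgD.
by apply/eqP; rewrite -(eqn_pmul2r D0) -(eqn_add2l (f 0%N)) eq_sum fg0.
Qed.

Variables (n D : nat).

(** The Kronecker substitution: the exponents D^i write the exponent vector of a
    monomial in base D. *)
Definition kron : {mpoly K[n]} -> {poly K} := mmap polyC (fun i : 'I_n => 'X^(D ^ i)).

Lemma kronM p q : kron (p * q) = kron p * kron q.
Proof. exact: rmorphM. Qed.

Lemma kron_inj p q : (msize p <= D)%N -> (msize q <= D)%N -> kron p = kron q -> p = q.
Proof.
move=> pD qD kpq; apply/mpolyP => m.
have wtE m' : mmap1 (fun i : 'I_n => 'X^(D ^ i)) m' =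
    'X^(\sum_(i < n) m' i * D ^ i) :> {poly K}.
  by rewrite expr_sum; apply: eq_bigr => i _; rewrite -exprM mulnC.
have wt_inj (m1 m2 : 'X_{1..n}) : (mdeg m1 < D)%N -> (mdeg m2 < D)%N ->
    (\sum_(i < n) m1 i * D ^ i = \sum_(i < n) m2 i * D ^ i)%N -> m1 = m2.
  move=> m1D m2D wt12; apply/mnmP => i; rewrite !(mnm_nth 0%N).
  apply: (@digits_inj n D (nth 0%N m1) (nth 0%N m2)) => // [j jn|].
    have le_mdeg (m' : 'X_{1..n}) : (nth 0%N m' j <= mdeg m')%N.
      by rewrite -(mnm_nth 0%N m' (Ordinal jn)) mdegE (bigD1 (Ordinal jn)) //= leq_addr.
    by rewrite !(leq_ltn_trans (le_mdeg _)).
  have tonth (m' : 'X_{1..n}) :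
      (\sum_(i < n) nth 0%N m' i * D ^ i = \sum_(i < n) m' i * D ^ i)%N.
    by apply: eq_bigr => j _; rewrite (mnm_nth 0%N).
  by rewrite !tonth.
have [mD|Dm] := ltnP (mdeg m) D; last first.
  by rewrite !memN_msupp_eq0 //; apply: msize_mdeg_ge; apply: leq_trans Dm.
have coefE p' : (msize p' <= D)%N -> (kron p')`_(\sum_(i < n) m i * D ^ i) = p'@_m.
  move=> p'D; rewrite /kron /mmap coef_sum.
  have termE m' : m' \in msupp p' ->
      ((p'@_m')%:P * mmap1 (fun i : 'I_n => 'X^(D ^ i)) m')`_(\sum_(i < n) m i * D ^ i) =
      p'@_m' * (m == m')%:R.
    move=> p'm'; rewrite wtE coefCM coefXn; congr (_ * (nat_of_bool _)%:R).
    apply/eqP/eqP => [|-> //]; apply: wt_inj => //.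
    exact: leq_trans (msize_mdeg_lt p'm') _.
  rewrite (eq_big_seq _ termE); have [p'm|p'm] := boolP (m \in msupp p').
    rewrite (bigD1_seq m) ?msupp_uniq //= eqxx mulr1 big1 ?addr0 // => m' /negPf.
    by rewrite eq_sym => ->; rewrite mulr0.
  rewrite (memN_msupp_eq0 p'm) big_seq big1 // => m' p'm'.
  by case: eqP p'm => [->|_ _]; rewrite ?p'm' ?mulr0.
by rewrite -!coefE // kpq.
Qed.

End Kronecker.

Section MpolySqfree.
Variables (K : fieldType) (n : nat).
Implicit Types f g h p q : {mpoly K[n]}.

Lemma divides_msize p f : f != 0 -> divides p f -> (msize p <= msize f)%N.
Proof.
move=> f0 [t f_def]; move: f0; rewrite f_def mulf_eq0 negb_or => /andP[t0 p0].
by rewrite msizeM //; have := t0; rewrite -msize_poly_eq0 -lt0n => /prednK <-; apply: leq_addl.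
Qed.

(** Divisors of f have degree at most that of f, a range on which the Kronecker
    substitution is injective, and it maps them to divisors of the image of f.
    Proportional images come from proportional divisors. *)
Lemma mpoly_finite_divisors f : f != 0 ->
  exists s : seq {mpoly K[n]}, forall p, divides p f ->
    exists2 q, q \in s & associates q p.
Proof.
move=> f0; pose D := msize f.
have kf0 : kron D f != 0.
  apply: contra_neq f0 => kf0; apply: (@kron_inj K n D) => //; rewrite ?msize0 //.
  by rewrite kf0 /kron mmap0.
have [l lP] := poly_finite_divisors kf0.
have [s sP] := finite_section (fun p => divides p f) (fun p u => kron D p %= u) l.
exists s => p pf; have [t f_def] := pf.
have [|u lu pu] := lP (kron D p); first by rewrite f_def kronM dvdp_mulIr.
have [q sq [qf qu]] := sP p u pf lu pu; exists q => //.
have /eqpf_eq[a a0 kpq] : kron D p %= kron D q by rewrite (eqp_trans pu) // eqp_sym.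
exists a%:MP; first by rewrite rmorph_unit // unitfE.
apply: (@kron_inj K n D); first exact: divides_msize.
  by apply: divides_msize => //; case: qf => t' f_def'; exists (a^-1 *: t');
     rewrite mul_mpolyC -scalerAr -scalerAl scalerA divff ?scale1r.
by rewrite kronM [kron D _%:MP]mmapC kpq mul_polyC.
Qed.

Lemma mpoly_nonunit_msize p : p != 0 -> p \isn't a GRing.unit -> (1 < msize p)%N.
Proof.
move=> p0; apply: contraR; rewrite -leqNgt => p1.
have := p0; rewrite -msize_poly_eq0 -lt0n => p1'.
have /msize_poly1P[a a0 ->] : msize p == 1%N by rewrite eqn_leq p1.
by rewrite rmorph_unit // unitfE.
Qed.

(** Divisors of f are split into irreducible ones by induction on the degree; each
    irreducible divisor is associated to a factor of h. *)
Lemma sqfree_part_power f h : f != 0 -> is_sqfree_part f h ->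
  exists k, divides f (h ^+ k).
Proof.
move=> f0 [l [_ l_div _ h_def]].
suff power k g : (msize g <= k)%N -> divides g f -> exists j, divides g (h ^+ j).
  by apply: (power _ _ (leqnn _)); exists 1; rewrite mul1r.
elim: k g => [|k IH] g gk [t f_def].
  by move: f0; rewrite f_def; move: gk; rewrite leqn0 msize_poly_eq0 => /eqP->; rewrite mulr0 eqxx.
have g0 : g != 0 by apply: contra_neq f0 => g0; rewrite f_def g0 mulr0.
have [Ug|Ng] := boolP (g \is a GRing.unit).
  by exists 0%N, g^-1; rewrite expr0 mulVr.
have [ig|nig] := classic (irreducible g).
  have [|p lp [u Uu g_def]] := l_div g ig; first by exists t.
  exists 1%N, (u^-1 * \prod_(q <- rem p l) q).
  by rewrite expr1 h_def (big_rem p) //= g_def mulrAC mulKr.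
have [q1 [q2 [g_def Nq1 Nq2]]] : exists q1 q2,
    [/\ g = q1 * q2, q1 \isn't a GRing.unit & q2 \isn't a GRing.unit].
  apply: NNPP => nog; apply: nig; split=> // q1 q2 g_def.
  apply: NNPP => /not_or_and[/negP Nq1 /negP Nq2].
  by apply: nog; exists q1, q2.
have := g0; rewrite g_def mulf_eq0 negb_or => /andP[q10 q20].
have s1 := mpoly_nonunit_msize q10 Nq1; have s2 := mpoly_nonunit_msize q20 Nq2.
have sg : msize g = (msize q1 + msize q2).-1 by rewrite g_def msizeM.
have [||j1 [t1 h1]] := IH q1; first by lia.
  by exists (t * q2); rewrite f_def g_def -mulrA [q2 * _]mulrC.
have [||j2 [t2 h2]] := IH q2; first by lia.
  by exists (t * q1); rewrite f_def g_def mulrA.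
exists (j1 + j2)%N, (t1 * t2); rewrite exprD h1 h2.
by rewrite mulrACA.
Qed.

End MpolySqfree.

(** * Groebner bases and saturation over a G-algebra *)

Lemma lincombE (R : fieldType) (A : algType R) (N : nat) (z : 'I_N -> A) p :
  lincomb (stdmon z) p = mmap (in_alg A) z p.
Proof. by apply: eq_bigr => a _; rewrite mulr_algl. Qed.

Lemma leadingE (R : fieldType) (A : algType R) (N r : nat) (z : 'I_N -> A) le
    (f : 'rV[A]_r) e p :
  leading (stdmon z) le f e p <-> lead (in_alg A) z le f e p.
Proof.
by split=> -[u [fu ue p_def]]; exists u; split=> // i; rewrite fu lincombE.
Qed.

Lemma in_algC (R : fieldType) (A : algType R) (p : R) (a : A) :
  in_alg A p * a = a * in_alg A p.
Proof. by rewrite mulr_algl mulr_algr. Qed.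

Section GAlgebraGroebner.
Variables (K : fieldType) (N r : nat) (A : algType K) (z : 'I_N -> A).
Variables (c : 'I_N -> 'I_N -> K) (d : 'I_N -> 'I_N -> {mpoly K[N]}).
Hypothesis hA : galgebra c d z.
Variable le : rel 'X_{1..N}.
Hypotheses (adm : admissible le) (ord_le : ordering_condition d le).

Local Notation expand := (mmap (in_alg A) z).
Local Notation lead := (lead (in_alg A) z le).

Lemma galg_span a : exists p, a = expand p.
Proof. by have [p [<- _]] := galg_basis hA a; exists p; rewrite lincombE. Qed.

Lemma galg_free p : expand p = 0 -> p = 0.
Proof.
have [q [_ uq]] := galg_basis hA 0 => p0.
by rewrite -(uq p) ?lincombE // -(uq 0) // lincombE mmap0.
Qed.

(** The ordering condition bounds only the greatest exponent of d_ij; the others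
    follow by transitivity. *)
Lemma galg_mon_mul a b : mon_mul (in_alg A) z le (fun p => p != 0) a b.
Proof.
apply: (mon_mul_nz (@in_algC _ A) adm (c := c) (d := d)) => [i j ij|i j ij|i j ij e de].
- by rewrite (galg_rel hA ij) lincombE mulr_algl.
- exact: (galg_coef hA).
have [d0|[a0 [[_ maxa] lea neq_a]]] := ord_le ij; first by rewrite d0 msupp0 in de.
have [_ tr _ _ _] := adm; rewrite /strict (tr _ _ _ (maxa _ de) lea) andbT.
apply: contra neq_a => /eqP eU; apply/eqP; case: adm => as_ _ _ _ _.
by apply: as_; rewrite lea -eU maxa.
Qed.

Lemma galg_lead_exists (f : 'rV[A]_r) : f != 0 -> exists e p, lead f e p.
Proof.
move=> f0; have [u fu] := fun_choice (fun i => galg_span (f 0 i)).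
by have [e [_ lead_f]] := lead_expand adm fu f0; exists e, (u e.1)@_e.2.
Qed.

(** The leading exponent in the definition of a Groebner basis is some leading
    exponent of f; freeness identifies it with the given one. *)
Lemma groebnerP (I : 'rV[A]_r -> Prop) G f e p :
  groebner z le I G -> I f -> lead f e p ->
  exists g e' p', [/\ g \in G, I g, lead g e' p' & mon_dvd e' e].
Proof.
move=> [GI gb] If lead_f.
have /eqP f0 := lead_vec_neq0 galg_free lead_f.
have [g [e1 [e2 [Gg [p1 /leadingE lead_g] [p2 /leadingE lead_f2] dvd]]]] := gb f If f0.
have [e_def _] := lead_unique adm galg_free lead_f lead_f2.
by exists g, e1, p1; rewrite e_def; split=> //; apply: GI.
Qed.

(** A Dickson basis of the set of leading exponents, with one element of I chosen
    for each. *)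
Lemma groebner_exists (I : 'rV[A]_r -> Prop) : exists G, groebner z le I G.
Proof.
have [l [lP ldvd]] := dickson_pos (fun e => exists g p, I g /\ lead g e p).
have [g gP] : exists g, forall e, e \in l -> I (g e) /\ exists p, lead (g e) e p.
  apply: (fun_choice (P := fun e g => e \in l -> I g /\ exists p, lead g e p)) => e.
  have [/lP[g [p [Ig lead_g]]]|] := boolP (e \in l); last by exists 0.
  by exists g; split=> //; exists p.
exists [fset g e | e in l]%fset; split=> [f /imfsetP[e le_ ->]|f If /eqP f0].
  by case: (gP e le_).
have [e [p lead_f]] := galg_lead_exists f0.
have [|e' le' dvd] := ldvd e; first by exists f, p.
have [_ [p' lead_g]] := gP e' le'.
exists (g e'), e', e; split=> //; first exact: in_imfset.
  by exists p'; apply/leadingE.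
by exists p; apply/leadingE.
Qed.

Section Saturation.
Variables (I : 'rV[A]_r -> Prop) (q : A).
Hypotheses (subI : left_submodule I) (qC : forall a, q * a = a * q).

Lemma qCX k a : q ^+ k * a = a * q ^+ k.
Proof. by apply/commr_sym/commrX. Qed.

Lemma colon_submodule k : left_submodule (colon I (q ^+ k)).
Proof.
split=> [|f g|a f]; rewrite /colon; first by rewrite scaler0; apply: lsub0.
  by rewrite scalerDr; apply: lsubD.
by rewrite scalerA qCX -scalerA; apply: lsubZ.
Qed.

Lemma colon_mono j k f : (j <= k)%N -> colon I (q ^+ j) f -> colon I (q ^+ k) f.
Proof. by move=> jk; rewrite /colon -(subnK jk) exprD -scalerA; apply: lsubZ. Qed.

Lemma colon_inf_submodule : left_submodule (colon_inf I q).
Proof.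
split=> [|f g [i If] [j Ig]|a f [i If]]; first by exists 0%N; apply: lsub0 (colon_submodule _).
  by exists (maxn i j); apply: lsubD (colon_submodule _) _ _ _ _;
    [apply: colon_mono If; apply: leq_maxl|apply: colon_mono Ig; apply: leq_maxr].
by exists i; apply: lsubZ (colon_submodule _) _ _ _.
Qed.

(** A finite Groebner basis of the union of the (I : q^i) lies in one of them, which
    therefore has the same leading exponents as the union; reduction over K shows
    that it is the whole union. *)
Lemma saturates : exists k, saturated_at I q k.
Proof.
have [G gbG] := groebner_exists (colon_inf I q).
have [k GI] : exists k, forall g, g \in G -> colon I (q ^+ k) g.
  have [e eP] : exists e : 'rV[A]_r -> nat, forall g, g \in G -> colon I (q ^+ e g) g.
    apply: (fun_choice (P := fun g e => g \in G -> colon I (q ^+ e) g)) => g.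
    have [Gg|] := boolP (g \in G); last by exists 0%N.
    by have [e Ie] := gbG.1 _ Gg; exists e.
  exists (\max_(g <- G) e g) => g Gg; apply: colon_mono (eP g Gg).
  by rewrite (big_rem g) //= leq_maxl.
exists k => f; split=> [Jf|If]; last by exists k.
have lead_dvd g e p : colon_inf I q g -> lead g e p -> exists g' e' p',
    [/\ colon I (q ^+ k) g', lead g' e' p', p' != 0 & mon_dvd e' e].
  move=> Jg lead_g.
  have [g' [e' [p' [Gg' _ lead_g' dvd]]]] := groebnerP gbG Jg lead_g.
  by exists g', e', p'; split=> //; [apply: GI|apply: lead_neq0 lead_g'].
have [||g Ig|t t0 If] := pseudo_reduction adm (@in_algC _ A) galg_span _ _ galg_mon_mul
  (colon_submodule k) colon_inf_submodule _ lead_dvd Jf.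
- exact: oner_neq0.
- by move=> s t; apply: mulf_neq0.
- by exists k.
have := lsubZ (colon_submodule k) (in_alg A t^-1) If.
by rewrite scalerA -rmorphM mulVf // rmorph1 scale1r.
Qed.

End Saturation.
End GAlgebraGroebner.

(** * Collecting the y-monomials of an antiblock ordering *)

Section BlockExponents.
Variables n m : nat.
Implicit Types (s t : 'X_{1..n + m}) (a : 'X_{1..n}) (b : 'X_{1..m}).

Definition join_exp a b : 'X_{1..n + m} :=
  [multinom match split k with inl i => a i | inr j => b j end | k < n + m].

Lemma xpart_join a b : xpart (join_exp a b) = a.
Proof. by apply/mnmP => i; rewrite !mnmE (unsplitK (inl _ i)). Qed.

Lemma ypart_join a b : ypart (join_exp a b) = b.
Proof. by apply/mnmP => j; rewrite !mnmE (unsplitK (inr _ j)). Qed.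

Lemma join_parts s : join_exp (xpart s) (ypart s) = s.
Proof.
by apply/mnmP => k; rewrite mnmE; case: splitP => i ki; rewrite mnmE; congr (s _); apply: val_inj.
Qed.

Lemma xpartD s t : xpart (s + t) = (xpart s + xpart t)%MM.
Proof. by apply/mnmP => i; rewrite !mnmE. Qed.

Lemma ypartD s t : ypart (s + t) = (ypart s + ypart t)%MM.
Proof. by apply/mnmP => j; rewrite !mnmE. Qed.

Lemma eq_parts s t : (s == t) = (xpart s == xpart t) && (ypart s == ypart t).
Proof.
apply/eqP/andP => [-> //|[/eqP xE /eqP yE]].
by rewrite -[s]join_parts xE yE join_parts.
Qed.

Variables (le1 : rel 'X_{1..n}) (le2 : rel 'X_{1..m}).
Hypotheses (adm1 : admissible le1) (adm2 : admissible le2).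
Local Notation le := (antiblock le1 le2).

Lemma antiblock_ypart s t : le s t -> le2 (ypart s) (ypart t).
Proof. by case/orP=> /andP[] // /eqP -> _; apply: adm_refl. Qed.

(** With a zero x-part in t, equality of the y-parts would make the x-part of s
    at most 0, hence s = t. *)
Lemma antiblock_strict_ypart s t :
  strict le s t -> xpart t = 0%MM -> strict le2 (ypart s) (ypart t).
Proof.
case/andP=> st lest t0; rewrite /strict antiblock_ypart // andbT.
apply: contra st => st; rewrite eq_parts st andbT t0.
move: lest; rewrite /antiblock st /= t0 => les0.
by case: adm1 => as_ _ _ min0 _; apply/eqP/as_; rewrite les0 min0.
Qed.

Lemma antiblock_admissible : admissible le.
Proof.
have [as1 tr1 tot1 min1 add1] := adm1; have [as2 tr2 tot2 min2 add2] := adm2.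
split.
- move=> s t; rewrite /antiblock; have [yE|yN] /= := eqVneq (ypart s) (ypart t).
    by move/as1=> xE; apply/eqP; rewrite eq_parts xE yE !eqxx.
  by rewrite !orbF => /as2 yE; rewrite yE eqxx in yN.
- move=> t s u; rewrite /antiblock.
  have [->|yst] /= := eqVneq (ypart s) (ypart t).
    by move=> lst /orP[->//|/andP[-> ltu]]; rewrite (tr1 _ _ _ lst ltu) orbT.
  rewrite orbF => lst /orP[/andP[ytu ltu]|/andP[/eqP <- _]]; last by rewrite yst lst.
  rewrite (tr2 _ _ _ lst ltu) andbT; apply/orP; left.
  by apply: contraNneq yst => su; apply/eqP/as2; rewrite lst su ltu.
- move=> s t; rewrite /antiblock; have [->|_] /= := eqVneq (ypart s) (ypart t).
    exact: tot1.
  by rewrite !orbF; apply: tot2.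
- move=> s; have -> : 0%MM = join_exp 0%MM 0%MM.
    by apply/eqP; rewrite eq_parts xpart_join ypart_join; apply/andP; split;
      apply/eqP/mnmP => i; rewrite !mnmE.
  by rewrite /antiblock xpart_join ypart_join min1 min2 andbT; case: eqVneq.
- move=> s t u; rewrite /antiblock !ypartD !xpartD eqm_add2r.
  by case/orP=> /andP[-> le_st]; [rewrite add2|rewrite add1 ?orbT].
Qed.

End BlockExponents.

Lemma frac_repr (R : idomainType) (x : {fraction R}) :
  exists a b : R, b != 0 /\ tofrac b * x = tofrac a.
Proof.
elim/quotW: x => x; exists (\n_x), (\d_x); split; first exact: denom_ratioP.
rewrite !piE; apply/eqmodP => /=.
by rewrite FracField.equivfE /FracField.mulf !numden_Ratio ?oner_eq0 ?mul1r ?mulr1 ?denom_ratioP.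
Qed.

Lemma common_denominator (R : idomainType) (s : seq {fraction R}) :
  exists2 D : R, D != 0 & forall x, x \in s -> exists a, tofrac D * x = tofrac a.
Proof.
elim: s => [|x s [D D0 IH]]; first by exists 1; rewrite ?oner_eq0.
have [a [b [b0 xE]]] := frac_repr x; exists (D * b); first exact: mulf_neq0.
move=> y; rewrite inE => /predU1P[->|/IH[a' yE]].
  by exists (D * a); rewrite !tofracM -xE mulrA.
by exists (b * a'); rewrite [D * b]mulrC !tofracM -yE mulrA.
Qed.

Section Blocks.
Variables (K : fieldType) (n m r : nat) (A : algType K) (z : 'I_(n + m) -> A).
Hypothesis hBZ : B_central z.

Local Notation x := (xvar z).
Local Notation y := (yvar z).
Local Notation P := {mpoly K[n]}.

Lemma xpoly_central (p : P) a : xpoly z p * a = a * xpoly z p.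
Proof. by apply: hBZ; exists p. Qed.

(** Packaged existentially, so that the canonical map K[x] -> A can be used as a
    ring morphism although its multiplicativity depends on the centrality of x. *)
Lemma xpoly_rmorph : exists xi : {rmorphism P -> A}, forall p, xi p = xpoly z p.
Proof.
have xC i a : GRing.comm a (x i).
  have := xpoly_central 'X_i a.
  by rewrite /xpoly lincombE mmapX mmap1U => /esym.
have fM : monoid_morphism (mmap (in_alg A) x).
  have [M1 MM] : multiplicative (mmap (in_alg A) x).
    by apply: commr_mmap_is_multiplicative => // p a b; apply: in_algC.
  by split.
pose f : {rmorphism P -> A} := HB.pack_for {rmorphism P -> A} (mmap (in_alg A) x)
  (GRing.isMonoidMorphism.Build _ _ _ fM).
by exists f => p; rewrite /xpoly lincombE.
Qed.

Variable xi : {rmorphism P -> A}.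
Hypothesis xiE : forall p, xi p = xpoly z p.

Lemma xiC p a : xi p * a = a * xi p.
Proof. by rewrite xiE xpoly_central. Qed.

Lemma xiX a : xi 'X_[a] = mmap1 x a.
Proof. by rewrite xiE /xpoly lincombE mmapX. Qed.

Lemma xi_alg (k : K) : xi k%:MP = in_alg A k.
Proof. by rewrite xiE /xpoly lincombE mmapC. Qed.

Lemma mon_parts s : mmap1 z s = xi 'X_[xpart s] * mmap1 y (ypart s).
Proof.
rewrite xiX /mmap1 big_split_ord /=; congr (_ * _);
  by apply: eq_bigr => i _; rewrite mnmE.
Qed.

(** Turns coordinates over K on the monomials in all variables into coordinates
    over K[x] on the monomials in y; see [by_y_expand]. *)
Definition by_y (p : {mpoly K[n + m]}) : {mpoly P[m]} :=
  \sum_(s <- msupp p) (p@_s *: 'X_[xpart s]) *: 'X_[ypart s].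

Lemma by_y_coef p b a : (by_y p)@_b@_a = p@_(join_exp a b).
Proof.
rewrite /by_y !raddf_sum /=.
have termE (s : 'X_{1..n + m}) : s \in msupp p ->
    ((p@_s *: 'X_[xpart s] : P) *: 'X_[ypart s] : {mpoly P[m]})@_b@_a =
    p@_s * (s == join_exp a b)%:R.
  move=> _; rewrite mcoeffZ mcoeffX eq_parts xpart_join ypart_join.
  case: (ypart s == b); last by rewrite mulr0 mcoeff0 andbF mulr0.
  by rewrite mulr1 mcoeffZ mcoeffX andbT.
rewrite (eq_big_seq _ termE).
have [ps|ps] := boolP (join_exp a b \in msupp p).
  rewrite (bigD1_seq (join_exp a b)) ?msupp_uniq //= eqxx mulr1 big1 ?addr0 // => s /negPf ->.
  by rewrite mulr0.
rewrite (memN_msupp_eq0 ps) big_seq big1 // => s ps'.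
by case: eqP ps => [<-|_ _]; rewrite ?ps' ?mulr0.
Qed.

Lemma by_y_expand p : mmap xi y (by_y p) = mmap (in_alg A) z p.
Proof.
rewrite /by_y raddf_sum /=; apply: eq_bigr => s _.
by rewrite mmapZ mmapX mon_parts -mul_mpolyC rmorphM mulrA xi_alg.
Qed.

Lemma by_y_supp p b :
  b \in msupp (by_y p) -> exists a, join_exp a b \in msupp p.
Proof.
rewrite mcoeff_msupp => pb.
have : msupp (by_y p)@_b != [::] by rewrite msupp_eq0.
case E : (msupp _) => [//|a l] _; exists a.
by rewrite mcoeff_msupp -by_y_coef -mcoeff_msupp E mem_head.
Qed.

Lemma supp_by_y p s : s \in msupp p -> ypart s \in msupp (by_y p).
Proof.
rewrite !mcoeff_msupp; apply: contra_neq => ps.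
by rewrite -(join_parts s) -by_y_coef ps mcoeff0.
Qed.

(** The inverse regrouping; it gives the freeness of A over K[x]. *)
Definition collect (w : {mpoly P[m]}) : {mpoly K[n + m]} :=
  \sum_(b <- msupp w) \sum_(a <- msupp w@_b) w@_b@_a *: 'X_[join_exp a b].

Lemma collect_expand w : mmap (in_alg A) z (collect w) = mmap xi y w.
Proof.
rewrite /collect raddf_sum /=; apply: eq_bigr => b _; rewrite raddf_sum /=.
rewrite [in RHS](mpolyE w@_b) raddf_sum big_distrl /=; apply: eq_bigr => a _.
by rewrite mmapZ mmapX mon_parts xpart_join ypart_join -mul_mpolyC rmorphM xi_alg mulrA.
Qed.

Lemma collect_coef w a b : (collect w)@_(join_exp a b) = w@_b@_a.
Proof.
rewrite /collect raddf_sum /=.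
have innerE b' : (\sum_(a' <- msupp w@_b') w@_b'@_a' *: 'X_[join_exp a' b'])@_(join_exp a b) =
    w@_b'@_a * (b' == b)%:R.
  rewrite raddf_sum /=.
  under eq_bigr => a' _ do rewrite mcoeffZ mcoeffX eq_parts !xpart_join !ypart_join.
  case: (b' == b); last by rewrite mulr0 big1 // => a' _; rewrite andbF mulr0.
  rewrite [in RHS](mpolyE w@_b') raddf_sum mulr1; apply: eq_bigr => a' _.
  by rewrite /= mcoeffZ mcoeffX andbT.
under eq_bigr => b' _ do rewrite innerE.
have [wb|wb] := boolP (b \in msupp w).
  by rewrite (bigD1_seq b) ?msupp_uniq //= eqxx mulr1 big1 ?addr0 // => b' /negPf->; rewrite mulr0.
rewrite (memN_msupp_eq0 wb) mcoeff0 big_seq big1 // => b' wb'.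
by case: eqP wb => [<-|_ _]; rewrite ?wb' ?mulr0.
Qed.

Variables (c : 'I_(n + m) -> 'I_(n + m) -> K).
Variables (d : 'I_(n + m) -> 'I_(n + m) -> {mpoly K[n + m]}).
Hypothesis hA : galgebra c d z.

Lemma y_span a : exists w, a = mmap xi y w.
Proof. by have [p ->] := galg_span hA a; exists (by_y p); rewrite by_y_expand. Qed.

(** Freeness over K[x] comes from the K-basis of standard monomials, since the
    pairs of an x-monomial and a y-monomial are exactly these. *)
Lemma y_free w : mmap xi y w = 0 -> w = 0.
Proof.
rewrite -collect_expand => /(galg_free hA) w0.
by apply/mpolyP => b; apply/mpolyP => a; rewrite -collect_coef w0 !mcoeff0.
Qed.

Lemma xi_inj p : xi p = 0 -> p = 0.
Proof.
move=> p0; have /y_free/eqP : mmap xi y p%:MP = 0 by rewrite mmapC.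
by rewrite mpolyC_eq0 => /eqP.
Qed.

Lemma xi_torsionfree p a : p != 0 -> xi p * a = 0 -> a = 0.
Proof.
have [w ->] := y_span a => p0; rewrite -mmapZ => /y_free/eqP.
by rewrite mscalerI (negPf p0) => /eqP ->; rewrite mmap0.
Qed.

Variables (le1 : rel 'X_{1..n}) (le2 : rel 'X_{1..m}).
Hypotheses (adm1 : admissible le1) (adm2 : admissible le2).
Local Notation le := (antiblock le1 le2).
Hypothesis ord_le : ordering_condition d le.

Let adm : admissible le := antiblock_admissible adm1 adm2.

(** A bound with zero x-part is needed: in general smaller terms may share the
    y-part of s and differ from it only in their x-part. *)
Lemma low_ypart s a : xpart s = 0%MM ->
  low (in_alg A) z le s a -> low xi y le2 (ypart s) a.
Proof.
move=> s0 [p [-> lp]]; exists (by_y p); rewrite by_y_expand; split=> // b.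
move=> /by_y_supp[a' /lp lab].
by have := antiblock_strict_ypart adm1 adm2 lab s0; rewrite ypart_join.
Qed.

(** The exponents of y-monomials have zero x-part, so all lower terms of a product
    over K are also lower over K[x]. *)
Lemma y_mon_mul a b :
  mon_mul xi y le2 (fun p => exists2 k : K, k != 0 & p = k%:MP) a b.
Proof.
pose emb := @join_exp n m 0%MM.
have monE b' : mmap1 y b' = mmap1 z (emb b').
  by rewrite mon_parts xpart_join ypart_join mpolyX0 rmorph1 mul1r.
have embD : (emb a + emb b)%MM = emb (a + b)%MM.
  by apply/eqP; rewrite eq_parts xpartD ypartD !xpart_join !ypart_join addm0 !eqxx.
have [k [v [k0 low_v mul_ab]]] := galg_mon_mul hA adm ord_le (emb a) (emb b).
exists k%:MP, v; split; first by exists k.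
  by have := low_ypart _ low_v; rewrite embD xpart_join ypart_join => /(_ erefl).
by rewrite !monE mul_ab embD xi_alg.
Qed.

Lemma lead_ypart (f : 'rV[A]_r) e k : lead (in_alg A) z le f e k ->
  exists p, lead xi y le2 f (e.1, ypart e.2) p.
Proof.
move=> [u [fu [ue maxe] _]]; exists (by_y (u e.1))@_(ypart e.2).
exists (fun i => by_y (u i)); split=> // [i|]; first by rewrite by_y_expand.
split=> [|[i b] /= /by_y_supp[a uab]]; first exact: supp_by_y.
have := maxe (i, join_exp a b) uab; rewrite /pot /=.
case/orP=> [-> //|/andP[-> /(antiblock_ypart adm2)]].
by rewrite ypart_join => ->; rewrite orbT.
Qed.

Lemma lead_scale (f : 'rV[A]_r) e p q : q != 0 ->
  lead xi y le2 f e p -> lead xi y le2 (xi q *: f) e (q * p).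
Proof.
move=> q0 [u [fu [ue maxe] ->]]; exists (fun i => q *: u i); split=> [i||].
- by rewrite mxE fu mmapZ.
- split=> [|e']; first by rewrite (perm_mem (msuppZ _ q0)).
  by rewrite (perm_mem (msuppZ _ q0)); apply: maxe.
by rewrite mcoeffZ.
Qed.

(** * Passage to the localization *)
Section Localization.
Variables (Q : algType {fraction P}) (phi : {rmorphism A -> Q}).
Hypothesis hQ : is_localization (inS z) phi.
Hypothesis hQx : forall p : P, phi (xpoly z p) = (tofrac p)%:A.

Lemma inSE a : inS z a <-> exists2 p, p != 0 & a = xi p.
Proof.
split=> [[[p ->] p0]|[p p0 ->]].
  by exists p; rewrite ?xiE //; apply: contra_notN p0 => /eqP->; rewrite -xiE rmorph0.
by split=> [|/xi_inj/eqP]; [exists p; rewrite xiE|rewrite (negPf p0)].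
Qed.

Lemma phi_inj a : phi a = 0 -> a = 0.
Proof.
by move=> /(loc_ker hQ)[s [/inSE[p p0 ->]]]; apply: xi_torsionfree.
Qed.

Lemma phi_expand w : phi (mmap xi y w) =
  mmap (in_alg Q) (fun j => phi (y j)) (map_mpoly (@tofrac _) w).
Proof.
rewrite [in LHS]/mmap rmorph_sum /= [in RHS]/mmap.
rewrite (perm_big _ (msupp_map_mpoly (f := @tofrac _) w _)) /=; last first.
  by move=> p q /eqP; rewrite tofrac_eq => /eqP.
apply: eq_bigr => b _; rewrite mcoeff_map_mpoly rmorphM /= xiE hQx rmorph_prod.
by congr (_ * _); apply: eq_bigr => j _; rewrite rmorphXn.
Qed.

(** Clearing denominators turns a relation over K(x) between the y-monomials of
    the localization into the image of a relation over K[x] in A. *)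
Lemma frac_free (w : {mpoly {fraction P}[m]}) :
  mmap (in_alg Q) (fun j => phi (y j)) w = 0 -> w = 0.
Proof.
move=> w0; have [D D0 clear] := common_denominator [seq w@_b | b <- msupp w].
have [num numE] : exists num : 'X_{1..m} -> P,
    forall b, b \in msupp w -> tofrac D * w@_b = tofrac (num b).
  apply: (fun_choice (P := fun b p => b \in msupp w -> tofrac D * w@_b = tofrac p)) => b.
  have [wb|] := boolP (b \in msupp w); last by exists 0.
  by have [a Da] := clear _ (map_f _ wb); exists a.
pose w' : {mpoly P[m]} := \sum_(b <- msupp w) num b *: 'X_[b].
have wE : tofrac D *: w = map_mpoly (@tofrac _) w'.
  rewrite [in LHS](mpolyE w) scaler_sumr raddf_sum /=; apply: eq_big_seq => b wb.
  by rewrite map_mpolyZ map_mpolyX scalerA numE.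
have w'0 : w' = 0 by apply/y_free/phi_inj; rewrite phi_expand -wE mmapZ w0 mulr0.
by apply/eqP; move/eqP: wE; rewrite w'0 rmorph0 mscalerI tofrac_eq0 (negPf D0).
Qed.

Lemma lead_eps (f : 'rV[A]_r) e p : lead xi y le2 f e p ->
  lead (in_alg Q) (fun j => phi (y j)) le2 (eps phi f) e (tofrac p).
Proof.
have frac_inj : injective (@tofrac P) by move=> q q' /eqP; rewrite tofrac_eq => /eqP.
move=> [u [fu [ue maxe] ->]]; exists (fun i => map_mpoly (@tofrac _) (u i)); split=> [i||].
- by rewrite mxE fu phi_expand.
- split=> [|e']; first by rewrite (perm_mem (msupp_map_mpoly _ frac_inj)).
  by rewrite (perm_mem (msupp_map_mpoly _ frac_inj)); apply: maxe.
by rewrite mcoeff_map_mpoly.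
Qed.

(** Leading coefficients in the localization are determined by the vector, as the
    y-monomials are linearly independent over K(x). *)
Lemma lc_epsP (g : 'rV[A]_r) e p q :
  lead xi y le2 g e p -> lc_eps z le2 phi g (tofrac q) -> p = q.
Proof.
move=> /lead_eps lead_g [e' /leadingE lead_g'].
by have [_ /eqP] := lead_unique adm2 frac_free lead_g lead_g'; rewrite tofrac_eq => /eqP.
Qed.

Lemma S_closureP (I : 'rV[A]_r -> Prop) f :
  S_closure phi (inS z) I f <-> exists2 q, q != 0 & I (xi q *: f).
Proof.
have epsZ a g : phi a *: eps phi g = eps phi (a *: g).
  by apply/rowP => i; rewrite !mxE rmorphM.
split=> [[s [g [/inSE[q q0 ->] Ig]]]|[q q0 Iqf]].
  rewrite epsZ => eq_eps; exists q => //; suff -> : xi q *: f = g by [].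
  apply/rowP => i; apply/subr0_eq/phi_inj; rewrite rmorphB.
  by move/rowP/(_ i): eq_eps; rewrite !mxE => ->; rewrite subrr.
exists (xi q), (xi q *: f); split; [by apply/inSE; exists q|by []|by rewrite epsZ].
Qed.

Lemma S_closure_submodule I : left_submodule I ->
  left_submodule (S_closure phi (inS z) (r := r) I).
Proof.
move=> subI; split=> [|f g /S_closureP[p p0 If] /S_closureP[q q0 Ig]|a f /S_closureP[q q0 If]];
  apply/S_closureP.
- by exists 1; rewrite ?oner_eq0 // scaler0; apply: lsub0.
- exists (p * q); first exact: mulf_neq0.
  rewrite scalerDr; apply: lsubD => //; last by rewrite rmorphM -scalerA; apply: lsubZ.
  by rewrite mulrC rmorphM -scalerA; apply: lsubZ.
by exists q => //; rewrite scalerA xiC -scalerA; apply: lsubZ.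
Qed.

Lemma lc_eps_exists (g : 'rV[A]_r) : g != 0 ->
  exists p, p != 0 /\ lc_eps z le2 phi g (tofrac p).
Proof.
move=> g0; have [e [k lead_g]] := galg_lead_exists hA adm g0.
have [p lead_y] := lead_ypart lead_g; exists p; split; first exact: lead_neq0 lead_y.
by exists (e.1, ypart e.2); apply/leadingE/lead_eps.
Qed.

Lemma lc_prod_neq0 (H : {fset 'rV[A]_r}) (lc : 'rV[A]_r -> P) :
  (forall g, g \in H -> g != 0 -> lc_eps z le2 phi g (tofrac (lc g))) ->
  \prod_(g <- H | g != 0) lc g != 0.
Proof.
move=> lcH; rewrite prodf_seq_neq0; apply/allP => g Hg; apply/implyP => g0.
have [p [p0 [e /leadingE lead_g]]] := lc_eps_exists g0.
have [e' /leadingE lead_g'] := lcH g Hg g0.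
have [_ /eqP] := lead_unique adm2 frac_free lead_g lead_g'.
by rewrite tofrac_eq => /eqP <-.
Qed.

Lemma h_exists (H : {fset 'rV[A]_r}) : exists h, is_h z le2 phi H h.
Proof.
have [lc lcP] : exists lc : 'rV[A]_r -> P,
    forall g, g != 0 -> lc_eps z le2 phi g (tofrac (lc g)).
  apply: (fun_choice (P := fun g p => g != 0 -> lc_eps z le2 phi g (tofrac p))) => g.
  have [->|g0] := eqVneq g 0; first by exists 0; rewrite ?eqxx.
  by have [p [_ lc_g]] := lc_eps_exists g0; exists p.
have lcH g : g \in H -> g != 0 -> lc_eps z le2 phi g (tofrac (lc g)).
  by move=> _; apply: lcP.
have [h hP] := sqfree_part_exists (mpoly_finite_divisors (lc_prod_neq0 lcH)).
by exists h, lc.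
Qed.

(** Pseudo-reduction of the S-closure by H, with multipliers dividing powers of h. *)
Theorem S_closure_colon (I : 'rV[A]_r -> Prop) H h : left_submodule I ->
  groebner z le I H -> is_h z le2 phi H h ->
  forall f, S_closure phi (inS z) I f <-> colon_inf I (xpoly z h) f.
Proof.
move=> subI gbH [lc [lcH h_sqfree]].
have [N divN] := sqfree_part_power (lc_prod_neq0 lcH) h_sqfree.
have h0 : h != 0.
  have [l [l_irr _ _ ->]] := h_sqfree; rewrite prodf_seq_neq0; apply/allP => p lp.
  by have [[]] := l_irr p lp.
have xiXh i : xi (h ^+ i) = xpoly z h ^+ i by rewrite rmorphXn xiE.
pose T t := exists i, divides t (h ^+ i).
have lc_T g : g \in H -> g != 0 -> T (lc g).
  move=> Hg g0; have [t hN] := divN; exists N; rewrite hN (big_rem g) //= g0.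
  by exists (t * \prod_(g' <- rem g H | g' != 0) lc g'); rewrite -mulrA [_ * lc g]mulrC.
move=> f; split=> [Sf|[i If]]; last first.
  by apply/S_closureP; exists (h ^+ i); rewrite ?expf_neq0 // xiXh.
have lead_dvd g e p : S_closure phi (inS z) I g -> lead xi y le2 g e p ->
    exists g' e' p', [/\ I g', lead xi y le2 g' e' p', T p' & mon_dvd e' e].
  move=> /S_closureP[q q0 Iqg] lead_g; have lead_qg := lead_scale q0 lead_g.
  have qg0 := lead_vec_neq0 y_free lead_qg.
  have [e2 [k2 lead2]] := galg_lead_exists hA adm qg0.
  have [g' [e1 [k1 [Hg' Ig' lead1 [pos_eq dvd]]]]] := groebnerP hA adm gbH Iqg lead2.
  have [p2 /(lead_unique adm2 y_free lead_qg)[-> _]] := lead_ypart lead2.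
  have [p1 lead_g'] := lead_ypart lead1.
  have g'0 := lead_vec_neq0 y_free lead_g'.
  exists g', (e1.1, ypart e1.2), p1; split=> //.
    by rewrite (lc_epsP lead_g' (lcH g' Hg' g'0)); apply: lc_T.
  by split=> //= j; rewrite !mnmE.
have T1 : T 1 by exists 0%N, 1; rewrite mulr1.
have TM p q : T p -> T q -> T (p * q).
  move=> [i [p' pE]] [j [q' qE]]; exists (i + j)%N, (p' * q').
  by rewrite exprD pE qE mulrACA.
have mulT a b : mon_mul xi y le2 T a b.
  have [_ [v [[k k0 ->] low_v mul_ab]]] := y_mon_mul a b.
  exists k%:MP, v; split=> //; exists 0%N, (k^-1)%:MP.
  by rewrite -mpolyCM mulVf.
have IS g : I g -> S_closure phi (inS z) I g.
  by move=> Ig; apply/S_closureP; exists 1; rewrite ?oner_eq0 // rmorph1 scale1r.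
have [t [i [s hi]] If] := pseudo_reduction adm2 xiC y_span T1 TM mulT subI
  (S_closure_submodule subI) IS lead_dvd Sf.
by exists i; rewrite /colon -xiXh hi rmorphM -scalerA; apply: lsubZ.
Qed.

End Localization.
End Blocks.

(** * Termination and correctness *)
Lemma min_satindex (K : fieldType) (r : nat) (A : algType K) (I : 'rV[A]_r -> Prop) q k :
  saturated_at I q k -> exists j, is_satindex I q (Some j).
Proof.
elim/ltn_ind: k => k IH satk.
have [[j [jk satj]]|no_less] := classic (exists j, (j < k)%N /\ saturated_at I q j).
  exact: IH satj.
exists k; split=> // j satj; rewrite leqNgt; apply/negP => jk.
by case: no_less; exists j.
Qed.

Theorem proposition40
  (K : fieldType) (n m r : nat) (hn : (0 < n)%N) (hm : (0 < m)%N) (hr : (0 < r)%N)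
  (A : algType K) (z : 'I_(n + m) -> A)
  (c : 'I_(n + m) -> 'I_(n + m) -> K)
  (d : 'I_(n + m) -> 'I_(n + m) -> {mpoly K[n + m]})
  (hA : galgebra c d z)
  (hB : x_sub_galgebra d) (hBZ : B_central z)
  (le1 : rel 'X_{1..n}) (le2 : rel 'X_{1..m})
  (hle1 : admissible le1) (hle2 : admissible le2)
  (hle : ordering_condition d (antiblock le1 le2))
  (Q : algType {fraction {mpoly K[n]}}) (phi : {rmorphism A -> Q})
  (hQ : is_localization (inS z) phi)
  (hQx : forall p : {mpoly K[n]}, phi (xpoly z p) = (tofrac p)%:A)
  (I : 'rV[A]_r -> Prop) (hI : left_submodule I) :
  terminates_with z le1 le2 phi I
    (fun G => groebner z (antiblock le1 le2) (S_closure phi (inS z) I) G)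
    Start.
Proof.
have adm := antiblock_admissible hle1 hle2.
have [xi xiE] := xpoly_rmorph hBZ.
have gb_exists (J : 'rV[A]_r -> Prop) := groebner_exists hA adm J.
apply: TW_step => [|s1 step1].
  by have [H gbH] := gb_exists I; exists (HaveH n H); apply: Step1.
inversion_clear step1 as [H gbH| | |].
apply: TW_step => [|s2 step2].
  have [h hP] := h_exists xiE hA hle1 hle2 hQ hQx H.
  by exists (Haveh r A h); apply: Step2.
inversion_clear step2 as [|? h hP| |].
have closure_colon := S_closure_colon hBZ xiE hA hle1 hle2 hle hQ hQx hI gbH hP.
have qC a : xpoly z h * a = a * xpoly z h := xpoly_central hBZ h a.
have [k0 sat0] := saturates hA adm hle hI qC.
apply: TW_step => [|s3 step3].
  have [k satk] := min_satindex sat0.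
  by exists (Havek r A h (Some k)); apply: Step3.
inversion_clear step3 as [| |? k satk|].
case: k satk => [k [satk _]|no_sat]; last by case: (no_sat k0).
apply: TW_step => [|s4 step4].
  by have [G gbG] := gb_exists (colon I (xpoly z h ^+ k)); exists (Return n G); apply: Step4.
inversion_clear step4 as [| | |? ? G gbG].
apply: TW_return; case: gbG => GI gb.
have closureE f : S_closure phi (inS z) I f <-> colon I (xpoly z h ^+ k) f.
  by rewrite closure_colon; apply: satk.
split=> [g Gg|f Sf]; first by apply/closureE/GI.
by apply: gb; apply/closureE.
Qed.
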